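(* Let $n\ge 1$, $K\ge 2$, $\mu\in\mathbb{R}^n$, $\sigma^2>0$ and $\rho\in[-1/(K-1),1]$ be fixed. Let $Y\sim\mathcal{N}(\mu,\sigma^2 I_n)$, and let $(\omega^1,\ldots,\omega^K)$ be random vectors in $\mathbb{R}^n$, jointly independent of $Y$, forming an exchangeable normal randomization with correlation $\rho$. Let $g:\mathbb{R}^n\to\mathbb{R}^n$ satisfy the smoothness-and-moment condition, and suppose $\mathbb{E}\left[\|g(Y)-Y\|_2^2\right]>0$. Then, as $\alpha\downarrow 0$, \[ \mathbb{E}\left[\operatorname{Var}(\mathrm{CV}_\alpha\mid Y)\right]= \begin{cases} O(1) & \text{if } \rho=-\frac{1}{K-1},\\ \Theta\left(\frac1\alpha\right) & \text{if } \rho>-\frac{1}{K-1}. \end{cases} \]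
   Context: Cross-validation estimator: for $\alpha>0$, \[ \mathrm{CV}_\alpha=\frac1K\sum_{k=1}^K\left\{\left\|g(Y+\sqrt\alpha\,\omega^k)-\left(Y-\tfrac{1}{\sqrt\alpha}\omega^k\right)\right\|_2^2-\frac1\alpha\|\omega^k\|_2^2\right\}. \] Exchangeable normal randomization with correlation $\rho$: (i) $(\omega^{\pi(1)},\ldots,\omega^{\pi(K)})$ has the same distribution as $(\omega^1,\ldots,\omega^K)$ for every permutation $\pi$ of $\{1,\ldots,K\}$; (ii) $\omega^k\sim\mathcal{N}(0,\sigma^2 I_n)$ for every $k$, and $\operatorname{Cov}(\omega^k,\omega^{k'})=\rho\sigma^2 I_n$ for every $k\ne k'$. Joint normality of $(\omega^1,\ldots,\omega^K)$ is not assumed. The joint law of $(\omega^1,\ldots,\omega^K)$ does not depend on $\alpha$. Smoothness-and-moment condition on a map $g:\mathbb{R}^n\to\mathbb{R}^n$: every component $g_i$ is weakly differentiable, meaning that there is a function $\nabla g_i:\mathbb{R}^n\to\mathbb{R}^n$ (the weak derivative) with \[ g_i(y+z)-g_i(y)=\int_0^1 z\cdot\nabla g_i(y+tz)\,dt\quad\text{for almost all } y,z\in\mathbb{R}^n; \] $\nabla g$ denotes the $n\times n$ Jacobian matrix with $i$-th row $\nabla g_i$; and there exists $\alpha_0>0$ such that, for $Z_{\alpha_0}\sim\mathcal{N}(\mu,(1+\alpha_0)\sigma^2I_n)$, $\mathbb{E}\|g(Z_{\alpha_0})\|_2^4<\infty$ and $\mathbb{E}\|\nabla g(Z_{\alpha_0})\|_{\mathrm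 F}^2<\infty$, where $\|\cdot\|_{\mathrm F}$ is the Frobenius norm. *)

(* Defs.v *)
From HB Require Import structures.
From mathcomp Require Import all_boot all_order all_algebra all_fingroup.
From mathcomp Require Import all_classical all_reals all_analysis.

Set Implicit Arguments.
Unset Strict Implicit.
Unset Printing Implicit Defensive.

Import Order.TTheory GRing.Theory Num.Theory.
Import numFieldNormedType.Exports.

Local Open Scope classical_set_scope.
Local Open Scope ring_scope.

(* Matrices over a measurable type carry the sigma-algebra generated by their
   entries; over R this is the Borel sigma-algebra. *)
Definition measure_matrix_display : measure_display -> measure_display.
Proof. exact. Qed.

Section measurable_matrix.
Context {d : measure_display} {T : measurableType d}.
Variables m n : nat.

Definition entries_set_system : set (set 'M[T]_(m, n)) :=
  \bigcup_(ij in [set: 'I_m * 'I_n])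
    preimage_set_system setT (fun M : 'M[T]_(m, n) => M ij.1 ij.2) measurable.

Let matrix_set0 : <<s entries_set_system >> set0.
Proof. exact: sigma_algebra0. Qed.

Let matrix_setC A :
  <<s entries_set_system >> A -> <<s entries_set_system >> (~` A).
Proof. exact: sigma_algebraC. Qed.

Let matrix_bigcup (F : (set 'M[T]_(m, n))^nat) :
  (forall i, <<s entries_set_system >> (F i)) ->
  <<s entries_set_system >> (\bigcup_i (F i)).
Proof. exact: sigma_algebra_bigcup. Qed.

HB.instance Definition _ := @isMeasurable.Build (measure_matrix_display d)
  'M[T]_(m, n) <<s entries_set_system >> matrix_set0 matrix_setC matrix_bigcup.

End measurable_matrix.

Lemma measurable_entry d (T : measurableType d) m n (i : 'I_m) (j : 'I_n) :
  measurable_fun setT (fun M : 'M[T]_(m, n) => M i j).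
Proof.
move=> _ Y mY; rewrite setTI; apply: sub_sigma_algebra.
by exists (i, j) => //; exists Y => //; rewrite setTI.
Qed.

Lemma measurable_fun_mxP d d' (U : measurableType d') (T : measurableType d)
    m n (f : U -> 'M[T]_(m, n)) :
  (forall i j, measurable_fun setT (fun x => f x i j)) ->
  measurable_fun setT f.
Proof.
move=> mf; apply: (@measurability _ _ U 'M[T]_(m, n) setT f (@entries_set_system _ T m n)) => //.
move=> _ [_ [[i j] _ [B mB <-]] <-].
by rewrite !setTI; have := mf i j measurableT B mB; rewrite setTI.
Qed.

Section product_measure_rV.
Context {R : realType}.

Definition rV_cons n (xv : measurableTypeR R * 'rV[R]_n) : 'rV[R]_n.+1 :=
  \row_i oapp (fun j => xv.2 0 j) xv.1 (unlift ord0 i).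

Definition rV_uncons n (v : 'rV[R]_n.+1) : measurableTypeR R * 'rV[R]_n :=
  (v 0 0, \row_j v 0 (lift ord0 j)).

Lemma rV_consK n : cancel (@rV_cons n) (@rV_uncons n).
Proof.
move=> [x v]; rewrite /rV_uncons mxE unlift_none /=; congr pair.
by apply/rowP => j; rewrite !mxE liftK.
Qed.

Lemma measurable_rV_cons n : measurable_fun setT (@rV_cons n).
Proof.
apply: measurable_fun_mxP => i j.
under eq_fun do rewrite mxE.
case: unliftP => [k _|_] /=; last exact: measurable_fst.
exact: (measurableT_comp (measurable_entry 0 k) measurable_snd).
Qed.

Lemma measurable_rV_uncons n : measurable_fun setT (@rV_uncons n).
Proof.
apply: measurable_fun_pair; first exact: measurable_entry.
apply: measurable_fun_mxP => i j.
by under eq_fun do rewrite mxE; exact: measurable_entry.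
Qed.

Section step.
Variables (n : nat).
Variables (m1 : {sigma_finite_measure set (measurableTypeR R) -> \bar R})
  (m2 : {sigma_finite_measure set 'rV[R]_n -> \bar R}).

Definition product_rV_cons : set ('rV[R]_n.+1) -> \bar R :=
  pushforward (m1 \x m2)%E (@rV_cons n).

Let product_rV_cons0 : product_rV_cons set0 = 0%E.
Proof. by rewrite /product_rV_cons /pushforward preimage_set0 measure0. Qed.

Let product_rV_cons_ge0 A : (0 <= product_rV_cons A)%E.
Proof. by rewrite /product_rV_cons /pushforward; exact: measure_ge0. Qed.

Let product_rV_cons_sigma_additive : semi_sigma_additive product_rV_cons.
Proof.
have mpre A : measurable A -> measurable (@rV_cons n @^-1` A).
  by move=> mA; rewrite -[X in measurable X]setTI; exact: measurable_rV_cons.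
move=> F mF tF mUF; rewrite /product_rV_cons /pushforward preimage_bigcup.
apply: measure_semi_sigma_additive.
- by move=> k; exact: mpre.
- apply/trivIsetP => /= i j _ _ ij; rewrite -preimage_setI.
  by move/trivIsetP : tF => /(_ _ _ _ _ ij) ->//; rewrite preimage_set0.
- by rewrite -preimage_bigcup; exact: mpre.
Qed.

HB.instance Definition _ := isMeasure.Build _ _ _ product_rV_cons
  product_rV_cons0 product_rV_cons_ge0 product_rV_cons_sigma_additive.

Let product_rV_cons_sigma_finite : sigma_finite setT product_rV_cons.
Proof.
have /sigma_finiteP[F [TF ndF Foo]] := sigma_finiteT m1.
have /sigma_finiteP[G [TG ndG Goo]] := sigma_finiteT m2.
exists (fun k => @rV_uncons n @^-1` (F k `*` G k)) => [|k].
  rewrite -preimage_bigcup (_ : \bigcup_k _ = setT) ?preimage_setT//.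
  rewrite -setXTT TF TG predeqE => -[x y]; split.
    by move=> [k _ []/= ? ?]; split; exists k.
  move=> [/= [i _ Fix] [j _ Gjy]]; exists (maxn i j) => //; split.
  - by move: x Fix; exact/subsetPset/ndF/leq_maxl.
  - by move: y Gjy; exact/subsetPset/ndG/leq_maxr.
have [mF Fk_fin] := Foo k; have [mG Gk_fin] := Goo k; split.
  rewrite -[X in measurable X]setTI.
  by apply: measurable_rV_uncons => //; exact: measurableX.
rewrite /product_rV_cons /pushforward -comp_preimage.
rewrite (_ : _ \o _ = id); last by apply/funext => x /=; rewrite rV_consK.
by rewrite preimage_id product_measure1E// lte_mul_pinfty// ge0_fin_numE.
Qed.

HB.instance Definition _ := Measure_isSigmaFinite.Build _ _ _ product_rV_cons
  product_rV_cons_sigma_finite.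

End step.

Fixpoint product_measure_rV n :
    ('I_n -> {sigma_finite_measure set (measurableTypeR R) -> \bar R}) ->
    {sigma_finite_measure set 'rV[R]_n -> \bar R} :=
  match n with
  | 0 => fun _ => dirac (0 : 'rV[R]_0)
  | k.+1 => fun m =>
      product_rV_cons (m ord0) (product_measure_rV (fun i => m (lift ord0 i)))
  end.

End product_measure_rV.

Lemma product_measure_rVE {R : realType} n
    (m : 'I_n -> {sigma_finite_measure set (measurableTypeR R) -> \bar R})
    (A : 'I_n -> set R) : (forall i, measurable (A i)) ->
  product_measure_rV m [set v : 'rV[R]_n | forall i, A i (v 0 i)] =
  (\prod_(i < n) m i (A i))%E.
Proof.
elim: n => [|n IH] in m A *.
  move=> _; rewrite big_ord0 /= diracE mem_set// => -[].
  by move=> [].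
move=> mA; rewrite big_ord_recl -IH; last by move=> i; exact: mA.
rewrite -product_measure1E; last 2 first.
- exact: (mA ord0).
- rewrite (_ : [set v | _] = \bigcap_(i in [set: 'I_n])
      ((fun v : 'rV[R]_n => v 0 i) @^-1` A (lift ord0 i))).
    apply: fin_bigcap_measurable => // i _.
    by rewrite -[X in measurable X]setTI; apply: measurable_entry => //; exact: mA.
  by apply/seteqP; split => [v H i _|v H i]; exact: H.
rewrite /= /product_rV_cons /pushforward.
congr (product_measure1 _ _ _).
apply/seteqP; split => [[x v] /= H|[x v] /= [Hx Hv] i].
  split => [|i]; first by have := H ord0; rewrite mxE unlift_none.
  by have := H (lift ord0 i); rewrite mxE liftK.
by rewrite mxE; case: unliftP => [j ->|->].
Qed.

Section gaussian.
Context {R : realType}.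

Definition lebesgue_rV n : {sigma_finite_measure set 'rV[R]_n -> \bar R} :=
  product_measure_rV (fun _ : 'I_n => lebesgue_measure).

(* N(mu, v I_n); [normal_prob] takes a standard deviation, [v] is a variance. *)
Definition normal_rV n (mu : 'rV[R]_n) (v : R) :
    {sigma_finite_measure set 'rV[R]_n -> \bar R} :=
  product_measure_rV (fun i : 'I_n => normal_prob (mu 0 i) (Num.sqrt v)).

(* Euclidean norm of a row vector, Frobenius norm of a matrix; the library norm
   on matrices is the maximum norm. *)
Definition l2norm m n (A : 'M[R]_(m, n)) : R :=
  Num.sqrt (\sum_i \sum_j A i j ^+ 2).

Definition dotv n (u v : 'rV[R]_n) : R := \sum_j u 0 j * v 0 j.

(* The left-hand side being finite, the equality forces the integrand to be
   Lebesgue integrable on [0, 1]. *)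
Definition is_weak_gradient n (f : 'rV[R]_n -> R) (df : 'rV[R]_n -> 'rV[R]_n)
    : Prop :=
  {ae (lebesgue_rV n \x lebesgue_rV n)%E, forall yz : 'rV[R]_n * 'rV[R]_n,
    let y := yz.1 in let z := yz.2 in
    (f (y + z) - f y)%:E =
      (\int[lebesgue_measure]_(t in `[0%R, 1%R]) (dotv z (df (y + t *: z)))%:E)%E}.

Definition smooth_moment n (mu : 'rV[R]_n) (sigma2 : R)
    (g : 'rV[R]_n -> 'rV[R]_n) : Prop :=
  measurable_fun setT g /\
  exists J : 'rV[R]_n -> 'M[R]_n,
  [/\ measurable_fun setT J,
      forall i, is_weak_gradient (fun y => g y 0 i) (fun y => row i (J y)) &
      exists2 alpha0 : R, 0 < alpha0 &
        ((\int[normal_rV mu ((1 + alpha0) * sigma2)]_z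
            (l2norm (g z) ^+ 4)%:E < +oo)%E /\
         (\int[normal_rV mu ((1 + alpha0) * sigma2)]_z
            (l2norm (J z) ^+ 2)%:E < +oo)%E)].

End gaussian.

Section random_vectors.
Context {d : measure_display} {T : measurableType d} {R : realType}.
Variable P : probability T R.

Definition has_law d' (T' : measurableType d') (X : T -> T')
    (m : set T' -> \bar R) : Prop :=
  forall A, measurable A -> P (X @^-1` A) = m A.

Definition independent_rv d1 d2 (T1 : measurableType d1)
    (T2 : measurableType d2) (X1 : T -> T1) (X2 : T -> T2) : Prop :=
  forall A B, measurable A -> measurable B ->
    P (X1 @^-1` A `&` X2 @^-1` B) = (P (X1 @^-1` A) * P (X2 @^-1` B))%E.

(* The K-tuple (omega^1, ..., omega^K) as one random element: the K x n matrix
   with rows omega^k. *)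
Definition joint n K (omega : 'I_K -> T -> 'rV[R]_n) (w : T) : 'M[R]_(K, n) :=
  \matrix_(k < K) omega k w.

Definition exchangeable_normal n K (sigma2 rho : R)
    (omega : 'I_K -> T -> 'rV[R]_n) : Prop :=
  [/\ forall s : 'S_K, has_law (joint (fun k => omega (s k)))
        (pushforward P (joint omega)),
      forall k, has_law (omega k) (normal_rV 0 sigma2) &
      forall k k', k != k' -> forall i j : 'I_n,
        covariance P (fun w => omega k w 0 i) (fun w => omega k' w 0 j) =
        ((rho * sigma2) *+ (i == j))%:E].

Definition is_cond_exp d' (T' : measurableType d') (Y : T -> T') (X h : T -> R)
    : Prop :=
  [/\ P.-integrable setT (EFin \o X),
      P.-integrable setT (EFin \o h),
      measurable_fun setT (h : g_sigma_algebra_preimageType Y -> R) &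
      forall A, g_sigma_algebra_preimage Y A ->
        (\int[P]_(w in A) (h w)%:E = \int[P]_(w in A) (X w)%:E)%E].

(* A version of E[X | Y] (unique almost surely), and 0 if there is none. *)
Definition cond_exp d' (T' : measurableType d') (Y : T -> T') (X : T -> R)
    : T -> R :=
  xget (cst 0) [set h | is_cond_exp Y X h].

Definition sq_dev d' (T' : measurableType d') (Y : T -> T') (X : T -> R)
    : T -> R :=
  fun w => (X w - cond_exp Y X w) ^+ 2.

Definition cond_var d' (T' : measurableType d') (Y : T -> T') (X : T -> R)
    : T -> R :=
  cond_exp Y (sq_dev Y X).

Definition cond_var_defined d' (T' : measurableType d') (Y : T -> T')
    (X : T -> R) : Prop :=
  is_cond_exp Y X (cond_exp Y X) /\ is_cond_exp Y (sq_dev Y X) (cond_var Y X).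

Definition CV n K (g : 'rV[R]_n -> 'rV[R]_n) (Y : T -> 'rV[R]_n)
    (omega : 'I_K -> T -> 'rV[R]_n) (alpha : R) : T -> R :=
  fun w => K%:R^-1 * \sum_(k < K)
    (l2norm (g (Y w + Num.sqrt alpha *: omega k w)
             - (Y w - (Num.sqrt alpha)^-1 *: omega k w)) ^+ 2
     - alpha^-1 * l2norm (omega k w) ^+ 2).

End random_vectors.

(* Main.v *)
Require Import Defs.
From mathcomp Require Import all_boot all_order all_algebra all_fingroup.
From mathcomp Require Import all_classical all_reals all_analysis.
From mathcomp Require Import measurable_realfun.
From mathcomp Require Import ring lra.

(** Write s = sqrt alpha and Y_k = Y + s w_k. Expanding the square, the terms
    |w_k|^2 / alpha cancel and
      CV = 1/K sum_k (|g(Y_k) - Y|^2 + (2 / s) w_k . (g(Y_k) - Y)) = M + N,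
    where M = 2 / (K s) (sum_k w_k) . (g(Y) - Y) freezes g at Y, and N averages the
    remainders |g(Y_k) - Y|^2 + (2 / s) w_k . (g(Y_k) - g(Y)).

    The part M is a function of Y times a centred sum independent of Y. Its conditional
    mean is zero and E M^2 = L / alpha, with
      L = 4 / K^2 * K sigma2 (1 + (K - 1) rho) * E |g(Y) - Y|^2,
    which vanishes for rho = - 1 / (K - 1) and is positive for larger rho
    ([integral_total_dotv_sqr], [integral_cv_leading_sqr]).

    The part N is bounded in mean square by a constant B as alpha tends to 0
    ([cv_remainder_bounded]). Indeed weak differentiability gives
      |g(Y + s w) - g(Y)|^2 <= s^2 |w|^2 int_0^1 |J(Y + t s w)|^2 dt
    almost everywhere ([weak_difference_le]), and the factor s^2 absorbs the 1 / s^2.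
    What remains are moments of (Y + c w, w) for small c. Its density is dominated,
    uniformly in c, by a constant times the density of an independent normal pair with
    variances (1 + alpha0) sigma2 and 2 sigma2 ([normal_rV_shear_le]); this is proved on
    the line by Young's inequality in the exponent and carried to row vectors by
    induction on the dimension. The moment hypotheses at alpha0 then suffice.

    Conditionally on Y, the variance of CV is at most its second moment, and at least
    half that of M minus that of N, since M is conditionally centred ([cond_var_le],
    [cond_var_ge]). Hence
      L / (2 alpha) - B <= E Var(CV | Y) <= 2 L / alpha + 2 B,
    and both cases follow according to whether L vanishes. *)

Set Implicit Arguments.
Unset Strict Implicit.
Unset Printing Implicit Defensive.

Import Order.TTheory GRing.Theory Num.Theory.
Import numFieldNormedType.Exports.

Local Open Scope classical_set_scope.
Local Open Scope ring_scope.


(** * Measures given by a density, images of measures, affine substitution *)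

Section density.
Context {d : measure_display} {T : measurableType d} {R : realType}.
Variables (m nu : {measure set T -> \bar R}) (p : T -> R).
Hypotheses (mp : measurable_fun setT p) (p_ge0 : forall x, 0 <= p x).
Hypothesis nuE : forall A, measurable A -> nu A = (\int[m]_(x in A) (p x)%:E)%E.
Local Open Scope ereal_scope.

Import HBNNSimple.

Let density_nnsfun (h : {nnsfun T >-> R}) :
  \int[nu]_x (h x)%:E = \int[m]_x ((h x)%:E * (p x)%:E).
Proof.
under [LHS]eq_integral do rewrite fimfunE -fsumEFin//.
rewrite [LHS]ge0_integral_fsum//; last 2 first.
- by move=> r; exact/measurable_EFinP/measurableT_comp.
- by move=> r x _; rewrite EFinM nnfun_muleindic_ge0.
under [RHS]eq_integral => x _.
  rewrite fimfunE -fsumEFin// muleC ge0_mule_fsumr; last first.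
    by move=> r; rewrite EFinM nnfun_muleindic_ge0.
  over.
rewrite [RHS]ge0_integral_fsum//; last 2 first.
- move=> r; apply: emeasurable_funM; first exact/measurable_EFinP.
  exact/measurable_EFinP/measurableT_comp.
- move=> r x _; apply: mule_ge0; first by rewrite lee_fin.
  by rewrite EFinM nnfun_muleindic_ge0.
apply: eq_fsbigr => r _.
have mr : measurable (h @^-1` [set r]) by exact: measurable_funPTI.
have [r0|r0] := leP 0%R r; last first.
  rewrite preimage_nnfun0// indic0.
  by rewrite !integral0_eq// => x _; rewrite /= mulr0 ?mule0.
under eq_integral do rewrite EFinM.
under [RHS]eq_integral do rewrite EFinM muleCA.
rewrite !ge0_integralZl//.
- rewrite integral_indic// setIT nuE//; congr (_ * _).
  rewrite [LHS]integral_mkcond; apply: eq_integral => x _.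
  by rewrite patchE indicE; case: ifP; rewrite ?mule1 ?mule0.
- by apply: emeasurable_funM; exact/measurable_EFinP.
- by move=> x _; rewrite mule_ge0// lee_fin.
- exact/measurable_EFinP.
Qed.

(** Both sides are linear in f and continuous along increasing limits, so it is
    enough to compare them on the level sets of simple functions. *)
Lemma ge0_integral_density (f : T -> \bar R) : measurable_fun setT f ->
  (forall x, 0 <= f x) -> \int[nu]_x f x = \int[m]_x (f x * (p x)%:E).
Proof.
move=> mf f0; pose g := nnsfun_approx measurableT mf.
have fE x : f x = limn (EFin \o g ^~ x).
  by apply/esym/cvg_lim => //; exact: (cvg_nnsfun_approx measurableT mf).
have ndg x : {homo (fun n => g n x) : a b / (a <= b)%N >-> (a <= b)%R}.
  by move=> a b ab; exact/lefP/nd_nnsfun_approx.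
transitivity (\int[nu]_x (limn (fun n => (g n x)%:E))).
  by apply: eq_integral => x _; exact: fE.
rewrite monotone_convergence//; last 3 first.
- by move=> n; exact/measurable_EFinP.
- by move=> n x _; rewrite lee_fin.
- by move=> x _ a b ab; rewrite lee_fin ndg.
transitivity (\int[m]_x (limn (fun n => (g n x)%:E * (p x)%:E))); last first.
  apply: eq_integral => x _; apply/cvg_lim => //.
  apply: cvgeZr => //.
  exact: (cvg_nnsfun_approx measurableT mf).
rewrite monotone_convergence//.
- by apply: congr_lim; apply/funext => n; exact: density_nnsfun.
- by move=> n; apply: emeasurable_funM; exact/measurable_EFinP.
- by move=> n x _; rewrite mule_ge0// lee_fin.
- by move=> x _ a b ab; rewrite lee_pmul ?lee_fin// ndg.
Qed.

End density.

Section image_measure.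
Context {d d' : measure_display} {T1 : measurableType d}
  {T2 : measurableType d'} {R : realType}.
Variables (m : {measure set T1 -> \bar R}) (f : T1 -> T2).
Hypothesis mf : measurable_fun setT f.

(** The measurability proof is part of the term, so that the image measure can be
    nested in other measures (scaling, uniqueness of product measures). *)
Definition image_measure : {measure set T2 -> \bar R}.
Proof. by refine (pushforward m f). Defined.

Lemma ge0_integral_image_measure (g : T2 -> \bar R) : measurable_fun setT g ->
  (forall x, 0 <= g x)%E -> (\int[image_measure]_y g y = \int[m]_x g (f x))%E.
Proof. by move=> mg g0; rewrite ge0_integral_pushforward. Qed.

End image_measure.

Section lebesgue_affine.
Context {R : realType}.
Local Notation mu := (@lebesgue_measure R).
Variables (c a : R).
Hypothesis c0 : c != 0.
Let phi : measurableTypeR R -> measurableTypeR R := fun x => c * x + a.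

Let mphi : measurable_fun setT phi.
Proof. by apply: measurable_funD => //; exact: measurable_funM. Qed.

(* Up to the factor |c|, Lebesgue measure and its image under x |-> c x + a agree on
   half-open intervals; for c < 0 the preimage is closed on the other side. *)
Let lebesgue_affine (A : set (measurableTypeR R)) : measurable A ->
  mu A = (`|c|%:E * mu (phi @^-1` A))%E.
Proof.
move=> mA.
have c0' : 0 <= `|c| by [].
pose nu := mscale (NngNum c0') (image_measure mu mphi).
have -> : (`|c|%:E * mu (phi @^-1` A))%E = nu A by [].
apply: lebesgue_measure_unique => // X [[x y] /= _ <-].
rewrite /nu /mscale /= /pushforward.
rewrite lebesgue_measure_itv/=.
have [cpos|cneg] := ltP 0 c.
  rewrite (_ : phi @^-1` _ = `](x - a) / c, (y - a) / c]%classic); last first.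
    apply/seteqP; split => z /=; rewrite !in_itv/= /phi ltr_pdivrMr// ler_pdivlMr//.
      by move=> /andP[? ?]; apply/andP; split; lra.
    by move=> /andP[? ?]; apply/andP; split; lra.
  rewrite lebesgue_measure_itv/= !lte_fin ltr_pM2r ?invr_gt0// ltrD2r.
  case: ifPn => _; last by rewrite mule0.
  rewrite -!EFinB -EFinM gtr0_norm//; congr EFin.
  by field; rewrite gt_eqF.
have {}cneg : c < 0 by rewrite lt_neqAle c0.
rewrite (_ : phi @^-1` _ = `[(y - a) / c, (x - a) / c[%classic); last first.
  apply/seteqP; split => z /=; rewrite !in_itv/= /phi ltr_ndivlMr// ler_ndivrMr//.
    by move=> /andP[? ?]; apply/andP; split; lra.
  by move=> /andP[? ?]; apply/andP; split; lra.
rewrite lebesgue_measure_itv/= !lte_fin ltr_nM2r ?invr_lt0// ltrD2r.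
case: ifPn => _; last by rewrite mule0.
rewrite -!EFinB -EFinM ltr0_norm//; congr EFin.
by field; rewrite lt_eqF.
Qed.

Lemma ge0_integral_affine (f : R -> \bar R) : measurable_fun setT f ->
  (forall x, 0 <= f x)%E ->
  (\int[mu]_x f x = `|c|%:E * \int[mu]_x f (c * x + a)%R)%E.
Proof.
move=> mf f0.
have c0' : 0 <= `|c| by [].
transitivity (\int[mscale (NngNum c0') (image_measure mu mphi)]_x f x)%E.
  by apply: eq_measure_integral => A mA _; exact: lebesgue_affine.
by rewrite ge0_integral_mscale//= ge0_integral_image_measure.
Qed.

End lebesgue_affine.

(** * Normal laws on the line *)

Section normal_1d.
Context {R : realType}.
Local Notation mu := (@lebesgue_measure R).
Implicit Types (m s t v a : R) (f : R -> \bar R).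

Lemma ge0_integral_normal m s f : measurable_fun setT f ->
  (forall x, 0 <= f x)%E ->
  (\int[normal_prob m s]_x f x = \int[mu]_x (f x * (normal_pdf m s x)%:E))%E.
Proof.
move=> mf f0; apply: ge0_integral_density => //.
- exact: measurable_normal_pdf.
- exact: normal_pdf_ge0.
Qed.

Lemma integral_normal_cst m s (r : R) :
  (\int[normal_prob m s]_x r%:E = r%:E)%E.
Proof.
rewrite integral_cst//= [X in (_ * X)%E](_ : _ = 1%E) ?mule1//.
exact: (@probability_setT _ _ _ (normal_prob m s)).
Qed.

Lemma normal_peak_ratio s t : 0 < s -> 0 < t ->
  normal_peak s = t / s * normal_peak t.
Proof.
move=> s0 t0; rewrite /normal_peak -!mulrnAr (sqrtrM _ (sqr_ge0 s)) (sqrtrM _ (sqr_ge0 t)).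
rewrite !sqrtr_sqr !gtr0_norm//.
have : 0 < Num.sqrt ((pi : R) *+ 2) by rewrite sqrtr_gt0 mulrn_wgt0// pi_gt0.
move: (Num.sqrt _) => q q0.
by field; rewrite !gt_eqF.
Qed.

Lemma integral_normal_shift m s f : s != 0 -> measurable_fun setT f ->
  (forall x, 0 <= f x)%E ->
  (\int[normal_prob m s]_x f x = \int[normal_prob 0 s]_x f (x + m)%R)%E.
Proof.
move=> s0 mf f0.
have mf' : measurable_fun setT (fun x : R => f (x + m)).
  by apply: (measurableT_comp mf); exact: measurable_funD.
rewrite (ge0_integral_normal m s mf f0).
rewrite (ge0_integral_normal 0 s mf' (fun=> f0 _)).
rewrite (@ge0_integral_affine _ 1 m)//; last 2 first.
- apply: emeasurable_funM => //; apply/measurable_EFinP.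
  exact: measurable_normal_pdf.
- by move=> x; rewrite mule_ge0// lee_fin normal_pdf_ge0.
rewrite normr1 mul1e; apply: eq_integral => x _; rewrite mul1r; congr (_ * _%:E)%E.
rewrite !normal_pdfE// /normal_fun subr0 addrK//.
Qed.

Lemma integral_normal_opp s f : s != 0 -> measurable_fun setT f ->
  (forall x, 0 <= f x)%E ->
  (\int[normal_prob 0 s]_x f x = \int[normal_prob 0 s]_x f (- x)%R)%E.
Proof.
move=> s0 mf f0.
have mf' : measurable_fun setT (fun x : R => f (- x)) by exact: (measurableT_comp mf).
rewrite (ge0_integral_normal 0 s mf f0).
rewrite (ge0_integral_normal 0 s mf' (fun=> f0 _)).
rewrite (@ge0_integral_affine _ (-1) 0) ?oppr_eq0//; last 2 first.
- apply: emeasurable_funM => //; apply/measurable_EFinP.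
  exact: measurable_normal_pdf.
- by move=> x; rewrite mule_ge0// lee_fin normal_pdf_ge0.
rewrite normrN1 mul1e; apply: eq_integral => x _.
rewrite addr0 mulN1r; congr (_ * _%:E)%E.
by rewrite !normal_pdfE// /normal_fun !subr0 sqrrN.
Qed.

(** The exponent turning the density of N(0, s^2) into a multiple of that of
    N(0, t^2): multiplying the former by exp (gauss_rate s t x^2) does it. *)
Definition gauss_rate s t : R := (s ^+ 2 *+ 2)^-1 - (t ^+ 2 *+ 2)^-1.

Lemma integral_normal_exp_sq s t : 0 < s -> 0 < t ->
  (\int[normal_prob 0 s]_x (expR (gauss_rate s t * x ^+ 2))%:E = (t / s)%:E)%E.
Proof.
move=> s0 t0; rewrite ge0_integral_normal; last 2 first.
- apply/measurable_EFinP; apply: measurableT_comp => //.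
  by apply: measurable_funM => //; exact: measurable_funX.
- by move=> x; rewrite lee_fin expR_ge0.
under eq_integral => x _.
  rewrite -EFinM (_ : expR _ * _ = t / s * normal_pdf 0 t x); first over.
  rewrite !normal_pdfE ?gt_eqF// /normal_fun (normal_peak_ratio s0 t0).
  rewrite mulrCA -!mulrA; congr (_ * (_ * (_ * _))).
  rewrite -expRD; congr expR; rewrite /gauss_rate.
  by field; rewrite !gt_eqF.
under eq_integral do rewrite EFinM.
rewrite ge0_integralZl//.
- by rewrite integral_normal_pdf mule1.
- by apply/measurable_EFinP; exact: measurable_normal_pdf.
- by move=> x _; rewrite lee_fin normal_pdf_ge0.
- by rewrite lee_fin divr_ge0// ltW.
Qed.

(** exp (c x^2) >= (c x^2 / 2)^2, and exp (c x^2) is integrable for the exponent c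
    that doubles the standard deviation. *)
Lemma integral_normal_pow4_lty m s : 0 < s ->
  (\int[normal_prob m s]_x (x ^+ 4)%:E < +oo)%E.
Proof.
move=> s0; rewrite integral_normal_shift ?gt_eqF//; last 2 first.
- by apply/measurable_EFinP; exact: measurable_funX.
- by move=> x; rewrite lee_fin exprn_even_ge0.
pose c : R := gauss_rate s (2 * s).
have c0 : 0 < c.
  by rewrite /c /gauss_rate (_ : _ - _ = 3 / (8 * s ^+ 2)) ?divr_gt0 ?mulr_gt0 ?exprn_gt0//; field; rewrite gt_eqF.
pose B : R := 8 * (4 / c ^+ 2).
have ub x : (x + m) ^+ 4 <= B * expR (c * x ^+ 2) + 8 * m ^+ 4.
  have h1 : (x + m) ^+ 4 <= 8 * x ^+ 4 + 8 * m ^+ 4.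
    have : 0 <= (x - m) ^+ 2 by exact: sqr_ge0.
    have : 0 <= (x ^+ 2 - m ^+ 2) ^+ 2 by exact: sqr_ge0.
    have : (x + m) ^+ 2 <= 2 * (x ^+ 2 + m ^+ 2).
      by have := sqr_ge0 (x - m); nra.
    move=> h2 h3 _.
    have h4 : ((x + m) ^+ 2) ^+ 2 <= (2 * (x ^+ 2 + m ^+ 2)) ^+ 2.
      by rewrite lerXn2r// nnegrE ?sqr_ge0// mulr_ge0// addr_ge0// sqr_ge0.
    by nra.
  have h2 : (c * x ^+ 2 / 2) ^+ 2 <= expR (c * x ^+ 2).
    have -> : expR (c * x ^+ 2) = expR (c * x ^+ 2 / 2) ^+ 2.
      by rewrite -expRM_natl; congr expR; field.
    have cx : 0 <= c * x ^+ 2 / 2 by rewrite divr_ge0// mulr_ge0 ?sqr_ge0// ltW.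
    rewrite lerXn2r ?nnegrE ?expR_ge0//.
    by apply: le_trans (expR_ge1Dx _); rewrite lerDr.
  have h3 : x ^+ 4 <= 4 / c ^+ 2 * expR (c * x ^+ 2).
    apply: (@le_trans _ _ (4 / c ^+ 2 * (c * x ^+ 2 / 2) ^+ 2)).
      by rewrite le_eqVlt; apply/orP; left; apply/eqP; field; rewrite gt_eqF.
    by rewrite ler_wpM2l// divr_ge0// sqr_ge0.
  by rewrite /B -mulrA; lra.
have mexp : measurable_fun setT (fun x : R => (expR (c * x ^+ 2))%:E).
  apply/measurable_EFinP; apply: measurableT_comp => //.
  by apply: measurable_funM => //; exact: measurable_funX.
have B0 : 0 <= B by rewrite mulr_ge0// divr_ge0// sqr_ge0.
apply: (@le_lt_trans _ _
  (\int[normal_prob 0 s]_x (B%:E * (expR (c * x ^+ 2))%:E + (8 * m ^+ 4)%:E))%E).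
  apply: ge0_le_integral => //.
  - by move=> x _; rewrite lee_fin exprn_even_ge0.
  - apply/measurable_EFinP/measurable_funX.
    exact: measurable_funD.
  - by apply: emeasurable_funD => //; exact: emeasurable_funM.
  - by move=> x _; rewrite -EFinM -EFinD lee_fin ub.
rewrite ge0_integralD//; last 3 first.
- by move=> x _; rewrite -EFinM lee_fin mulr_ge0// expR_ge0.
- exact: emeasurable_funM.
- by move=> x _; rewrite lee_fin mulr_ge0// exprn_even_ge0.
rewrite ge0_integralZl//.
rewrite integral_normal_exp_sq ?mulr_gt0// integral_normal_cst.
by rewrite -EFinM -EFinD ltry.
Qed.

Lemma integral_normal_sqr_lty s : 0 < s ->
  (\int[normal_prob 0 s]_x (x ^+ 2)%:E < +oo)%E.
Proof.
move=> s0; apply: (@le_lt_trans _ _ (\int[normal_prob 0 s]_x (1 + (x ^+ 4)%:E))%E).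
  apply: ge0_le_integral => //.
  - by move=> x _; rewrite lee_fin sqr_ge0.
  - by apply/measurable_EFinP; exact: measurable_funX.
  - by apply: emeasurable_funD => //; apply/measurable_EFinP; exact: measurable_funX.
  - move=> x _; rewrite -EFinD lee_fin.
    by have := sqr_ge0 (x ^+ 2 - 1); have := sqr_ge0 x; nra.
rewrite ge0_integralD//; last 2 first.
- by move=> x _; rewrite lee_fin exprn_even_ge0.
- by apply/measurable_EFinP; exact: measurable_funX.
rewrite integral_normal_cst lte_add_pinfty ?ltry//.
exact: integral_normal_pow4_lty.
Qed.

(** The exact exponential moments give the variance without integrating by parts.
    For M = E X^2 and c = gauss_rate s (u s), the inequality 1 + c x^2 <= exp (c x^2)
    integrates to 1 + c M <= u. It holds for u on both sides of 1, where the two sides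
    agree; comparing first-order terms at u = 1 from above and below forces M = s^2. *)
Lemma integral_normal_sqr s : 0 < s ->
  (\int[normal_prob 0 s]_x (x ^+ 2)%:E = (s ^+ 2)%:E)%E.
Proof.
move=> s0.
have m2 : measurable_fun setT (fun x : R => (x ^+ 2)%:E).
  by apply/measurable_EFinP; exact: measurable_funX.
have ge2 : (0 <= \int[normal_prob 0 s]_x (x ^+ 2)%:E)%E.
  by apply: integral_ge0 => x _; rewrite lee_fin sqr_ge0.
have : (\int[normal_prob 0 s]_x (x ^+ 2)%:E)%E \is a fin_num.
  by rewrite ge0_fin_numE// integral_normal_sqr_lty.
have int2 : (normal_prob 0 s).-integrable setT (fun x : R => (x ^+ 2)%:E).
  apply/integrableP; split => //.
  under eq_integral do rewrite gee0_abs ?lee_fin ?sqr_ge0//.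
  exact: integral_normal_sqr_lty.
case E : (\int[normal_prob 0 s]_x (x ^+ 2)%:E)%E => [M| |]// _.
have key u : 0 < u -> 1 + (1 - u ^- 2) * (M / (2 * s ^+ 2)) <= u.
  move=> u0; have t0 : 0 < u * s by rewrite mulr_gt0.
  have <- : u * s / s = u by field; rewrite gt_eqF.
  rewrite -lee_fin -(integral_normal_exp_sq s0 t0).
  have -> : (1 + (1 - (u * s / s) ^- 2) * (M / (2 * s ^+ 2)))%:E =
      (\int[normal_prob 0 s]_x (1 + (gauss_rate s (u * s))%:E * (x ^+ 2)%:E))%E.
    rewrite integralD//=; last 2 first.
    - apply/integrableP; split => //; under eq_integral do rewrite abse1.
      by rewrite integral_normal_cst ltry.
    - exact: integrableZl.
    rewrite integral_normal_cst integralZl// E -EFinM -EFinD.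
    by congr EFin; rewrite /gauss_rate; field; rewrite !gt_eqF.
  apply: le_integral => //.
  - apply: integrableD => //.
      apply/integrableP; split => //; under eq_integral do rewrite abse1.
      by rewrite integral_normal_cst ltry.
    exact: integrableZl.
  - apply/integrableP; split.
      apply/measurable_EFinP; apply: measurableT_comp => //.
      by apply: measurable_funM => //; exact: measurable_funX.
    under eq_integral do rewrite gee0_abs ?lee_fin ?expR_ge0//.
    by rewrite integral_normal_exp_sq// ltry.
  - by move=> x _; rewrite -EFinM -EFinD lee_fin expR_ge1Dx.
congr EFin.
have s2 : 0 < s ^+ 2 by rewrite exprn_gt0.
(* Dividing by u - 1 reverses the inequality when u < 1. *)
have {}key u : 0 < u -> u != 1 ->
    if 1 < u then (u + 1) * M <= 2 * u ^+ 2 * s ^+ 2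
    else 2 * u ^+ 2 * s ^+ 2 <= (u + 1) * M.
  move=> u0 u1; have := key _ u0.
  have u20 : 0 < u ^+ 2 by rewrite exprn_gt0.
  have -> : 1 + (1 - u ^- 2) * (M / (2 * s ^+ 2)) =
      u + (u - 1) * (((u + 1) * M - 2 * u ^+ 2 * s ^+ 2) / (2 * u ^+ 2 * s ^+ 2)).
    by field; rewrite !gt_eqF.
  rewrite -lerBrDl subrr.
  have q0 : 0 < 2 * u ^+ 2 * s ^+ 2 by rewrite !mulr_gt0.
  case: ltP => h.
    by rewrite pmulr_rle0 ?subr_gt0// pmulr_lle0 ?invr_gt0// subr_le0.
  rewrite nmulr_rle0; last by rewrite subr_lt0 lt_neqAle u1.
  by rewrite pmulr_lge0 ?invr_gt0// subr_ge0.
apply/eqP; rewrite eq_le; apply/andP; split; apply/ler_addgt0Pr => e e0.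
(* With u = 1 + h or 1 - h, the error 2 u^2 / (u + 1) - 1 is at most 4 h, and this h
   makes it smaller than e after scaling by s^2. *)
- pose h := e / (4 * s ^+ 2 + e).
  have h0 : 0 < h by rewrite divr_gt0// addr_gt0// mulr_gt0.
  have hE : h * (4 * s ^+ 2 + e) = e.
    by rewrite divfK// gt_eqF// addr_gt0// mulr_gt0.
  have h1 : h <= 1.
    by rewrite ler_pdivrMr ?mul1r ?lerDr ?addr_gt0 ?mulr_gt0// mulr_ge0// ltW.
  have := key (1 + h); rewrite ltrDl h0 addrC addr_gt0// => /(_ isT).
  rewrite -subr_eq0 addrK gt_eqF// => /(_ isT).
  nra.
- pose h := e / (4 * s ^+ 2 + e).
  have h0 : 0 < h by rewrite divr_gt0// addr_gt0// mulr_gt0.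
  have hE : h * (4 * s ^+ 2 + e) = e.
    by rewrite divfK// gt_eqF// addr_gt0// mulr_gt0.
  have h1 : h < 1.
    by rewrite ltr_pdivrMr ?mul1r ?ltrDr ?addr_gt0 ?mulr_gt0.
  have := key (1 - h); rewrite subr_gt0 h1 => /(_ isT).
  rewrite -subr_eq0 addrAC subrr sub0r oppr_eq0 gt_eqF// => /(_ isT).
  rewrite ltrDl oppr_gt0 ltNge ltW//=.
  nra.
Qed.

Lemma integral_normal_id s : 0 < s -> (\int[normal_prob 0 s]_x x%:E = 0)%E.
Proof.
move=> s0; rewrite integralE.
have mid : measurable_fun setT (fun x : R => x%:E) by exact/measurable_EFinP.
have mneg : measurable_fun setT ((fun x : R => x%:E) ^\-)%E by exact: measurable_funeneg.
rewrite [X in (_ - X)%E](_ : _ = \int[normal_prob 0 s]_x (EFin^\+ x))%E; last first.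
  rewrite (integral_normal_opp _ mneg) ?gt_eqF//.
  by apply: eq_integral => x _; rewrite funenegE funeposE EFinN oppeK.
have lty : (\int[normal_prob 0 s]_x (EFin^\+ x) < +oo)%E.
  apply: (@le_lt_trans _ _ (\int[normal_prob 0 s]_x (1 + (x ^+ 2)%:E))%E).
    apply: ge0_le_integral => //.
    - exact: measurable_funepos.
    - by apply: emeasurable_funD => //; apply/measurable_EFinP; exact: measurable_funX.
    - move=> x _; rewrite funeposE ge_max; apply/andP; split; rewrite -EFinD lee_fin.
        by have := sqr_ge0 (x - 1); nra.
      by rewrite addr_ge0// sqr_ge0.
  rewrite ge0_integralD//; last 2 first.
  - by move=> x _; rewrite lee_fin sqr_ge0.
  - by apply/measurable_EFinP; exact: measurable_funX.
  by rewrite integral_normal_cst integral_normal_sqr// -EFinD ltry.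
rewrite subee// ge0_fin_numE//.
exact: integral_ge0.
Qed.

Definition shear_const a : R := Num.sqrt (1 + a) * Num.sqrt 2.

(** If Y ~ N(m, v) and W ~ N(0, v) are independent, the density of (Y + c W, W) is at
    most a constant times that of a pair of independent normal variables with the
    inflated variances (1 + a) v and 2 v, uniformly over c^2 <= a / 2. This is what
    allows the moments of Y + c W, weighted by powers of W, to be bounded by moments
    taken at the single law N(m, (1 + a) v). *)
Lemma normal_pdf_shear_le m (c a v z w : R) : 0 < v -> 0 < a -> c ^+ 2 <= a / 2 ->
  normal_pdf m (Num.sqrt v) (z - c * w) * normal_pdf 0 (Num.sqrt v) w <=
  shear_const a * (normal_pdf m (Num.sqrt ((1 + a) * v)) z *
                   normal_pdf 0 (Num.sqrt (2 * v)) w).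
Proof.
move=> v0 a0 ca.
have a1 : 0 < 1 + a by rewrite addr_gt0.
have sv : 0 < Num.sqrt v by rewrite sqrtr_gt0.
have sav : 0 < Num.sqrt ((1 + a) * v) by rewrite sqrtr_gt0 mulr_gt0.
have s2v : 0 < Num.sqrt (2 * v) by rewrite sqrtr_gt0 mulr_gt0.
rewrite !normal_pdfE ?gt_eqF// /normal_fun.
rewrite {1}(normal_peak_ratio sv sav) (normal_peak_ratio sv s2v).
rewrite (_ : Num.sqrt ((1 + a) * v) / Num.sqrt v = Num.sqrt (1 + a)); last first.
  by rewrite sqrtrM ?ltW// mulfK// gt_eqF.
rewrite (_ : Num.sqrt (2 * v) / Num.sqrt v = Num.sqrt 2); last first.
  by rewrite sqrtrM// mulfK// gt_eqF.
have av0 : 0 <= (1 + a) * v by rewrite mulr_ge0// ltW.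
have v20 : 0 <= 2 * v by rewrite mulr_ge0// ltW.
rewrite (sqr_sqrtr (ltW v0)) (sqr_sqrtr av0) (sqr_sqrtr v20) /shear_const.
set p1 := normal_peak _; set p2 := normal_peak _.
rewrite [leLHS](_ : _ = Num.sqrt (1 + a) * Num.sqrt 2 * (p1 * p2) *
   (expR (- (z - c * w - m) ^+ 2 / (v *+ 2)) * expR (- (w - 0) ^+ 2 / (v *+ 2)))); last by ring.
rewrite [leRHS](_ : _ = Num.sqrt (1 + a) * Num.sqrt 2 * (p1 * p2) *
   (expR (- (z - m) ^+ 2 / ((1 + a) * v *+ 2)) * expR (- (w - 0) ^+ 2 / (2 * v *+ 2)))); last by ring.
apply: ler_wpM2l.
  by rewrite !mulr_ge0// ?sqrtr_ge0// normal_peak_ge0.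
rewrite -!expRD ler_expR subr0.
have key : (z - m) ^+ 2 / (1 + a) + w ^+ 2 / 2 <= (z - c * w - m) ^+ 2 + w ^+ 2.
  set x := z - c * w - m.
  have -> : z - m = x + c * w by rewrite /x; ring.
  (* Young's inequality |x + cw|^2 <= (1 + a)|x|^2 + (1 + 1/a) |cw|^2 *)
  have h1 : (x + c * w) ^+ 2 / (1 + a) <= x ^+ 2 + (c * w) ^+ 2 / a.
    rewrite ler_pdivrMr// -subr_ge0.
    rewrite (_ : _ - _ = (a * x - c * w) ^+ 2 / a); last by field; rewrite gt_eqF.
    by rewrite divr_ge0 ?sqr_ge0// ltW.
  have h2 : (c * w) ^+ 2 / a <= w ^+ 2 / 2.
    rewrite ler_pdivrMr// exprMn.
    have := sqr_ge0 w; nra.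
  lra.
rewrite -subr_ge0 (_ : _ - _ = ((z - c * w - m) ^+ 2 + w ^+ 2 -
   ((z - m) ^+ 2 / (1 + a) + w ^+ 2 / 2)) / (v *+ 2)); last by field; rewrite !gt_eqF.
by rewrite divr_ge0 ?subr_ge0// mulrn_wge0// ltW.
Qed.

Lemma normal_pdf_sqrt_le m v x : 0 < v ->
  normal_pdf m (Num.sqrt v) x <= normal_peak (Num.sqrt v).
Proof. by move=> v0; apply: normal_pdf_ub; rewrite gt_eqF ?sqrtr_gt0. Qed.

End normal_1d.

(** * Shears of pairs of measures on the line *)

Section partial_integral.
Context {d1 d2 : measure_display} {T1 : measurableType d1}
  {T2 : measurableType d2} {R : realType}.

Lemma measurable_integral_snd (m : {sigma_finite_measure set T2 -> \bar R})
    (f : T1 -> T2 -> \bar R) :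
  measurable_fun setT (fun xy : T1 * T2 => f xy.1 xy.2) ->
  (forall x y, 0 <= f x y)%E ->
  measurable_fun setT (fun x => \int[m]_y f x y)%E.
Proof.
move=> mf f0.
exact: (@measurable_fun_fubini_tonelli_F _ _ _ _ _ m (fun xy => f xy.1 xy.2)).
Qed.

Lemma measurable_integral_fst (m : {sigma_finite_measure set T1 -> \bar R})
    (f : T1 -> T2 -> \bar R) :
  measurable_fun setT (fun xy : T1 * T2 => f xy.1 xy.2) ->
  (forall x y, 0 <= f x y)%E ->
  measurable_fun setT (fun y => \int[m]_x f x y)%E.
Proof.
move=> mf f0.
exact: (@measurable_fun_fubini_tonelli_G _ _ _ _ _ m (fun xy => f xy.1 xy.2)).
Qed.

Lemma tonelli_swap (m1 : {sigma_finite_measure set T1 -> \bar R})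
    (m2 : {sigma_finite_measure set T2 -> \bar R}) (f : T1 -> T2 -> \bar R) :
  measurable_fun setT (fun xy : T1 * T2 => f xy.1 xy.2) ->
  (forall x y, 0 <= f x y)%E ->
  (\int[m1]_x \int[m2]_y f x y = \int[m2]_y \int[m1]_x f x y)%E.
Proof.
move=> mf f0.
exact: (@fubini_tonelli _ _ _ _ _ m1 m2 (fun xy => f xy.1 xy.2)).
Qed.

Lemma measurable_section_fst (f : T1 -> T2 -> \bar R) (y : T2) :
  measurable_fun setT (fun xy : T1 * T2 => f xy.1 xy.2) ->
  measurable_fun setT (f^~ y).
Proof. exact: (@measurable_fun_pair1 _ _ _ _ _ _ (fun xy => f xy.1 xy.2)). Qed.

End partial_integral.

Section shear_1d.
Context {R : realType}.
Local Notation mu := (@lebesgue_measure R).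
Local Notation RM := (measurableTypeR R).
Implicit Types (m : {sigma_finite_measure set RM -> \bar R}) (p : R -> R).

Definition lebesgue_density m p := [/\ measurable_fun setT p,
  (forall x, 0 <= p x) &
  forall f : RM -> \bar R, measurable_fun setT f -> (forall x, 0 <= f x)%E ->
    (\int[m]_x f x = \int[mu]_x (f x * (p x)%:E))%E].

Variables (m1 m2 m1' m2' : {sigma_finite_measure set RM -> \bar R}).
Variables (p1 p2 p1' p2' : R -> R).
Hypotheses (hp1 : lebesgue_density m1 p1) (hp2 : lebesgue_density m2 p2)
  (hp1' : lebesgue_density m1' p1') (hp2' : lebesgue_density m2' p2').
Variables (c b C : R).
Hypotheses (b0 : b != 0) (C0 : 0 <= C).
Hypothesis le_p : forall z w, p1 (z - c / b * w) * p2 (b^-1 * w) <=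
  `|b| * C * (p1' z * p2' w).

(** Substituting z = x + c y, then w = b y, in the double integral against the two
    densities; the Jacobian is |b|. *)
Lemma shear_1d_le (F : RM * RM -> \bar R) : measurable_fun setT F ->
  (forall x, 0 <= F x)%E ->
  (\int[m1]_x \int[m2]_y F (x + c * y, b * y)%R <=
   C%:E * \int[m1']_x \int[m2']_y F (x, y))%E.
Proof.
move=> mF F0.
have [mp1 p10 int1] := hp1; have [mp2 p20 int2] := hp2.
have [mp1' p10' int1'] := hp1'; have [mp2' p20' int2'] := hp2'.
have mF2 : measurable_fun setT (fun xy : RM * RM => F (xy.1, xy.2)).
  by under eq_fun do rewrite -surjective_pairing.
have mFT : measurable_fun setT
    (fun xy : RM * RM => F (xy.1 + c * xy.2, b * xy.2)%R).
  apply: (measurableT_comp mF); apply: measurable_fun_pair.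
    by apply: measurable_funD => //; exact: measurable_funM.
  exact: measurable_funM.
have mFb : measurable_fun setT (fun xy : RM * RM => F (xy.1, b * xy.2)%R).
  apply: (measurableT_comp mF); apply: measurable_fun_pair => //.
  exact: measurable_funM.
have mshift (k : R) : measurable_fun setT
    (fun xy : RM * RM => (p1 (xy.1 - k * xy.2))%:E).
  apply/measurable_EFinP; apply: (measurableT_comp mp1).
  by apply: measurable_funB => //; exact: measurable_funM.
have mG : measurable_fun setT (fun xy : RM * RM =>
    (F (xy.1, xy.2) * (p1 (xy.1 - c / b * xy.2))%:E)%E).
  exact: emeasurable_funM.
pose H w := (\int[mu]_z (F (z, w) * (p1 (z - c / b * w))%:E) * (p2 (b^-1 * w))%:E)%E.
have mH : measurable_fun setT H.
  apply: emeasurable_funM.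
    apply: (@measurable_integral_fst _ _ _ _ _ mu
      (fun z w => F (z, w) * (p1 (z - c / b * w))%:E)%E) => //.
    by move=> x y; rewrite mule_ge0// lee_fin.
  apply/measurable_EFinP; apply: (measurableT_comp mp2).
  exact: measurable_funM.
have H0 w : (0 <= H w)%E.
  apply: mule_ge0; rewrite ?lee_fin//.
  by apply: integral_ge0 => z _; rewrite mule_ge0// lee_fin.
have -> : (\int[m1]_x \int[m2]_y F (x + c * y, b * y)%R = \int[mu]_y H (b * y)%R)%E.
  rewrite (tonelli_swap m1 m2 (f := fun x y => F (x + c * y, b * y)%R) mFT (fun _ _ => F0 _)).
  rewrite int2; last 2 first.
  - exact: (measurable_integral_fst m1 (f := fun x y => F (x + c * y, b * y)%R) mFT (fun _ _ => F0 _)).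
  - by move=> y; apply: integral_ge0 => x _.
  apply: eq_integral => y _; rewrite /H mulKf//; congr (_ * _)%E.
  have msec : measurable_fun setT (fun x : RM => F (x + c * y, b * y)%R).
    exact: (@measurable_section_fst _ _ RM RM R (fun x y => F (x + c * y, b * y)%R) y mFT).
  rewrite int1//.
  rewrite [RHS](@ge0_integral_affine _ 1 (c * y)) ?oner_eq0//; last 2 first.
  - apply: emeasurable_funM.
      exact: (@measurable_section_fst _ _ RM RM R (fun x y => F (x, y)%R) (b * y) mF2).
    exact: (@measurable_section_fst _ _ RM RM R (fun x y => (p1 (x - c / b * y))%:E%R) (b * y) (mshift _)).
  - by move=> x; rewrite mule_ge0// lee_fin.
  rewrite normr1 mul1e; apply: eq_integral => x _; rewrite mul1r.
  by rewrite mulrA divfK// addrK.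
have mI : measurable_fun setT (fun y => \int[m1']_x F (x, y))%E.
  exact: (measurable_integral_fst m1' (f := fun x y => F (x, y)) mF2 (fun _ _ => F0 _)).
have I0 y : (0 <= \int[m1']_x F (x, y))%E by exact: integral_ge0.
have bC0 : 0 <= `|b| * C by rewrite mulr_ge0.
have HE : (\int[mu]_y H y <= (`|b| * C)%:E * \int[m1']_x \int[m2']_y F (x, y))%E.
  rewrite (tonelli_swap m1' m2' (f := fun x y => F (x, y)) mF2 (fun _ _ => F0 _)).
  rewrite int2'// -ge0_integralZl//; last 2 first.
  - by apply: emeasurable_funM => //; exact/measurable_EFinP.
  - by move=> x _; rewrite mule_ge0// lee_fin.
  apply: ge0_le_integral => //.
  - apply: emeasurable_funM => //.
    by apply: emeasurable_funM => //; exact/measurable_EFinP.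
  - move=> w _; rewrite /H.
    have msec : measurable_fun setT (fun x : RM => F (x, w)).
      exact: (@measurable_section_fst _ _ RM RM R (fun x y => F (x, y)%R) w mF2).
    have msec1 := @measurable_section_fst _ _ RM RM R (fun x y => (p1 (x - c / b * y))%:E%R) w (mshift _).
    rewrite int1'// muleA -ge0_integralZr//; last 3 first.
    - exact: emeasurable_funM.
    - by move=> z _; rewrite mule_ge0// lee_fin.
    - by rewrite lee_fin.
    rewrite -ge0_integralZl//; last 2 first.
    - by apply: emeasurable_funM => //; exact/measurable_EFinP.
    - by move=> z _; rewrite mule_ge0// lee_fin.
    rewrite -ge0_integralZr//; last 3 first.
    - apply: emeasurable_funM => //.
      by apply: emeasurable_funM => //; exact/measurable_EFinP.
    - by move=> z _; rewrite !mule_ge0// lee_fin.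
    - by rewrite lee_fin.
    apply: ge0_le_integral => //.
    - by move=> z _; rewrite !mule_ge0// lee_fin.
    - by apply: emeasurable_funM => //; apply: emeasurable_funM.
    - apply: emeasurable_funM => //.
      apply: emeasurable_funM => //.
      by apply: emeasurable_funM => //; exact/measurable_EFinP.
    - move=> z _; rewrite -muleA -EFinM.
      rewrite -[leRHS]muleA [leRHS]muleCA -muleA lee_wpmul2l//.
      by rewrite -!EFinM lee_fin [leRHS]mulrCA le_p.
have := HE; rewrite (@ge0_integral_affine _ b 0 b0 H)//.
under eq_integral do rewrite addr0.
by rewrite EFinM -muleA lee_pmul2l// lte_fin normr_gt0.
Qed.

End shear_1d.

(** * Shears of product measures on row vectors *)

Section shear_rV.
Context {R : realType}.
Local Notation RM := (measurableTypeR R).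
Local Notation smeasure := {sigma_finite_measure set RM -> \bar R}.

Lemma ge0_integral_rV_cons n (m : 'I_n.+1 -> smeasure) (f : 'rV[R]_n.+1 -> \bar R) :
  measurable_fun setT f -> (forall v, 0 <= f v)%E ->
  (\int[product_measure_rV m]_v f v =
   \int[m ord0]_x \int[product_measure_rV (fun i => m (lift ord0 i))]_v
     f (rV_cons (x, v)))%E.
Proof.
move=> mf f0.
set m0 := m ord0; set m' := product_measure_rV (fun i => m (lift ord0 i)).
transitivity (\int[image_measure (m0 \x m')%E (@measurable_rV_cons R n)]_v f v)%E.
  exact: eq_measure_integral.
rewrite ge0_integral_image_measure//.
rewrite (@fubini_tonelli1 _ _ _ _ _ m0 m' (fun xv => f (rV_cons xv)))//.
exact: (measurableT_comp mf (@measurable_rV_cons R n)).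
Qed.

Lemma measurable_rV_consP d (T : measurableType d) n (f : T -> RM)
    (h : T -> 'rV[R]_n) : measurable_fun setT f -> measurable_fun setT h ->
  measurable_fun setT (fun t => rV_cons (f t, h t)).
Proof.
move=> mf mh; apply: (measurableT_comp (@measurable_rV_cons R n)).
exact: measurable_fun_pair.
Qed.

Lemma measurable_rV_D d (T : measurableType d) n (f h : T -> 'rV[R]_n) :
  measurable_fun setT f -> measurable_fun setT h ->
  measurable_fun setT (fun t => f t + h t).
Proof.
move=> mf mh; apply: measurable_fun_mxP => i j; under eq_fun do rewrite mxE.
by apply: measurable_funD;
  [exact: (measurableT_comp (measurable_entry i j) mf)|
   exact: (measurableT_comp (measurable_entry i j) mh)].
Qed.

Lemma measurable_rV_Z d (T : measurableType d) n (k : T -> R) (h : T -> 'rV[R]_n) :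
  measurable_fun setT k -> measurable_fun setT h ->
  measurable_fun setT (fun t => k t *: h t).
Proof.
move=> mk mh; apply: measurable_fun_mxP => i j; under eq_fun do rewrite mxE.
by apply: measurable_funM => //; exact: (measurableT_comp (measurable_entry i j) mh).
Qed.

Lemma rV_cons_shear n (c x y : R) (v w : 'rV[R]_n) :
  rV_cons (x, v) + c *: rV_cons (y, w) = rV_cons (x + c * y, v + c *: w).
Proof. by apply/rowP => i; rewrite !mxE; case: unliftP => [j|] _ /=; rewrite ?mxE. Qed.

Lemma rV_cons_scale n (b y : R) (w : 'rV[R]_n) :
  b *: rV_cons (y, w) = rV_cons (b * y, b *: w).
Proof. by apply/rowP => i; rewrite !mxE; case: unliftP => [j|] _ /=; rewrite ?mxE. Qed.

(** Tonelli, with the variables regrouped so that the two first coordinates are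
    integrated together. *)
Lemma integral2_rV_cons n (m1 m2 : 'I_n.+1 -> smeasure)
    (H : 'rV[R]_n.+1 * 'rV[R]_n.+1 -> \bar R) :
  measurable_fun setT H -> (forall x, 0 <= H x)%E ->
  (\int[product_measure_rV m1]_v \int[product_measure_rV m2]_w H (v, w) =
   \int[m1 ord0]_x \int[m2 ord0]_y
     \int[product_measure_rV (fun i => m1 (lift ord0 i))]_v
     \int[product_measure_rV (fun i => m2 (lift ord0 i))]_w
        H (rV_cons (x, v), rV_cons (y, w)))%E.
Proof.
move=> mH H0.
rewrite ge0_integral_rV_cons; last 2 first.
- exact: (@measurable_fun_fubini_tonelli_F _ _ _ _ _ (product_measure_rV m2) H mH H0).
- by move=> v; exact: integral_ge0.
apply: eq_integral => x _.
have mHx : measurable_fun setT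
    (fun t : 'rV[R]_n * RM * 'rV[R]_n => H (rV_cons (x, t.1.1), rV_cons (t.1.2, t.2))).
  apply: (measurableT_comp mH); apply: measurable_fun_pair;
    apply: measurable_rV_consP => //.
  - exact: (measurableT_comp measurable_fst measurable_fst).
  - exact: (measurableT_comp measurable_snd measurable_fst).
pose m2' := product_measure_rV (fun i => m2 (lift ord0 i)).
rewrite -(tonelli_swap _ (m2 ord0) (f := fun v (y : RM) =>
  \int[m2']_w H (rV_cons (x, v), rV_cons (y, w)))%E); last 2 first.
- apply: (@measurable_integral_snd _ _ ('rV[R]_n * RM)%type _ _ m2'
    (fun t w => H (rV_cons (x, t.1), rV_cons (t.2, w)))) => //.
- by move=> v y; exact: integral_ge0.
apply: eq_integral => v _; rewrite ge0_integral_rV_cons//.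
exact: (measurable_fun_pair2 _ mH).
Qed.

Variables (c b C : R).
Hypothesis C0 : 0 <= C.

Definition shear_dominated (m1 m2 m1' m2' : smeasure) :=
  forall F : RM * RM -> \bar R, measurable_fun setT F -> (forall x, 0 <= F x)%E ->
  (\int[m1]_x \int[m2]_y F (x + c * y, b * y)%R <=
   C%:E * \int[m1']_x \int[m2']_y F (x, y))%E.

(** The shear acts coordinate by coordinate, so a one-dimensional domination
    tensorizes: the constant is raised to the power of the dimension. *)
Lemma shear_rV_le n (m1 m2 m1' m2' : 'I_n -> smeasure) :
  (forall i, shear_dominated (m1 i) (m2 i) (m1' i) (m2' i)) ->
  forall F : 'rV[R]_n * 'rV[R]_n -> \bar R, measurable_fun setT F ->
  (forall x, 0 <= F x)%E ->
  (\int[product_measure_rV m1]_v \int[product_measure_rV m2]_w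
      F (v + c *: w, b *: w)%R <=
   (C ^+ n)%:E *
   \int[product_measure_rV m1']_v \int[product_measure_rV m2']_w F (v, w))%E.
Proof.
elim: n => [|n IH] in m1 m2 m1' m2' *.
  move=> _ F mF F0; rewrite expr0 mul1e.
  rewrite le_eqVlt; apply/orP; left; apply/eqP.
  apply: eq_integral => v _; apply: eq_integral => w _; congr F.
  by congr pair; rewrite !thinmx0.
move=> dom F mF F0.
set P1 := product_measure_rV (fun i => m1 (lift ord0 i)).
set P2 := product_measure_rV (fun i => m2 (lift ord0 i)).
set P1' := product_measure_rV (fun i => m1' (lift ord0 i)).
set P2' := product_measure_rV (fun i => m2' (lift ord0 i)).
have mPsi d (T : measurableType d) (f1 f2 : T -> RM) (h1 h2 : T -> 'rV[R]_n)
    (H : 'rV[R]_n.+1 * 'rV[R]_n.+1 -> \bar R) :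
  measurable_fun setT H ->
  measurable_fun setT f1 -> measurable_fun setT f2 ->
  measurable_fun setT h1 -> measurable_fun setT h2 ->
  measurable_fun setT (fun t => H (rV_cons (f1 t, h1 t), rV_cons (f2 t, h2 t))).
  move=> mH mf1 mf2 mh1 mh2; apply: (measurableT_comp mH).
  by apply: measurable_fun_pair; exact: measurable_rV_consP.
pose G (xy : RM * RM) :=
  (\int[P1']_v \int[P2']_w F (rV_cons (xy.1, v), rV_cons (xy.2, w)))%E.
have mG : measurable_fun setT G.
  apply: (@measurable_integral_snd _ _ (RM * RM)%type _ _ P1'
    (fun xy v => \int[P2']_w F (rV_cons (xy.1, v), rV_cons (xy.2, w)))%E); last first.
    by move=> xy v; exact: integral_ge0.
  apply: (@measurable_integral_snd _ _ (RM * RM * 'rV[R]_n)%type _ _ P2'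
    (fun t w => F (rV_cons (t.1.1, t.2), rV_cons (t.1.2, w)))) => //.
  apply: (mPsi _ _ (fun t => t.1.1.1) (fun t => t.1.1.2) (fun t => t.1.2)) => //;
    repeat (apply: measurableT_comp => //).
have G0 xy : (0 <= G xy)%E.
  by apply: integral_ge0 => v _; exact: integral_ge0.
pose Fs (vw : 'rV[R]_n.+1 * 'rV[R]_n.+1) := F (vw.1 + c *: vw.2, b *: vw.2).
have Fs0 x : (0 <= Fs x)%E by exact: F0.
have mFs : measurable_fun setT Fs.
  apply: (measurableT_comp mF); apply: measurable_fun_pair.
    by apply: measurable_rV_D => //; exact: measurable_rV_Z.
  exact: measurable_rV_Z.
rewrite (integral2_rV_cons m1 m2 mFs (fun=> F0 _))// (integral2_rV_cons m1' m2' mF)//.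
rewrite -/P1 -/P2 -/P1' -/P2'.
have Cn0 : 0 <= C ^+ n by exact: exprn_ge0.
have mGs : measurable_fun setT (fun xy : RM * RM => G (xy.1 + c * xy.2, b * xy.2)%R).
  apply: (measurableT_comp mG); apply: measurable_fun_pair.
    by apply: measurable_funD => //; exact: measurable_funM.
  exact: measurable_funM.
have mkGs : measurable_fun setT
    (fun xy : RM * RM => (C ^+ n)%:E * G (xy.1 + c * xy.2, b * xy.2)%R)%E.
  exact: emeasurable_funM.
apply: (@le_trans _ _ (\int[m1 ord0]_x \int[m2 ord0]_y
    ((C ^+ n)%:E * G (x + c * y, b * y)%R))%E); last first.
  rewrite [leLHS](_ : _ = (C ^+ n)%:E *
    \int[m1 ord0]_x \int[m2 ord0]_y G (x + c * y, b * y)%R)%E; last first.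
    rewrite -ge0_integralZl//; last 2 first.
    - exact: (@measurable_fun_fubini_tonelli_F _ _ _ _ _ (m2 ord0) _ mGs (fun=> G0 _)).
    - by move=> x _; exact: integral_ge0.
    apply: eq_integral => x _; rewrite ge0_integralZl//.
    exact: (measurable_fun_pair2 _ mGs).
  by rewrite exprSr EFinM -muleA lee_wpmul2l ?lee_fin//; exact: (dom ord0).
have mQ : measurable_fun setT (fun xy : RM * RM => \int[P1]_v \int[P2]_w
    Fs (rV_cons (xy.1, v), rV_cons (xy.2, w)))%E.
  apply: (@measurable_integral_snd _ _ (RM * RM)%type _ _ P1
    (fun xy v => \int[P2]_w
      Fs (rV_cons (xy.1, v), rV_cons (xy.2, w)))%E); last first.
    by move=> xy v; exact: integral_ge0.
  apply: (@measurable_integral_snd _ _ (RM * RM * 'rV[R]_n)%type _ _ P2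
    (fun t w => Fs (rV_cons (t.1.1, t.2), rV_cons (t.1.2, w)))) => //.
  apply: (mPsi _ _ (fun t => t.1.1.1) (fun t => t.1.1.2) (fun t => t.1.2)) => //;
    repeat (apply: measurableT_comp => //).
have Q0 (xy : RM * RM) : (0 <= \int[P1]_v \int[P2]_w
    Fs (rV_cons (xy.1, v), rV_cons (xy.2, w)))%E.
  by apply: integral_ge0 => v _; exact: integral_ge0.
have kGs0 (xy : RM * RM) : (0 <= (C ^+ n)%:E * G (xy.1 + c * xy.2, b * xy.2)%R)%E.
  by rewrite mule_ge0.
apply: ge0_le_integral => //.
- by move=> x _; apply: integral_ge0 => y _; exact: (Q0 (x, y)).
- exact: (@measurable_fun_fubini_tonelli_F _ _ _ _ _ (m2 ord0) _ mQ Q0).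
- exact: (@measurable_fun_fubini_tonelli_F _ _ _ _ _ (m2 ord0) _ mkGs kGs0).
move=> x _; apply: ge0_le_integral => //.
- by move=> y _; exact: (Q0 (x, y)).
- exact: (measurable_fun_pair2 x mQ).
- exact: (measurable_fun_pair2 x mkGs).
move=> y _.
under eq_integral do under eq_integral do
  rewrite /Fs /= rV_cons_shear rV_cons_scale.
apply: (IH _ _ _ _ (fun i => dom (lift ord0 i))
  (fun vw => F (rV_cons (x + c * y, vw.1), rV_cons (b * y, vw.2)))) => //.
exact: (mPsi _ _ (fun=> x + c * y) (fun=> b * y)).
Qed.

End shear_rV.

Section shear_rV_special.
Context {R : realType}.
Local Notation smeasure := {sigma_finite_measure set (measurableTypeR R) -> \bar R}.
Variables (C : R) (n : nat) (m1 m2 m1' m2' : 'I_n -> smeasure).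
Variable F : 'rV[R]_n * 'rV[R]_n -> \bar R.
Hypotheses (C0 : 0 <= C) (mF : measurable_fun setT F) (F0 : forall x, (0 <= F x)%E).

Lemma translate_rV_le (c : R) :
  (forall i, shear_dominated c 1 C (m1 i) (m2 i) (m1' i) (m2' i)) ->
  (\int[product_measure_rV m1]_v \int[product_measure_rV m2]_w
      F (v + c *: w, w)%R <=
   (C ^+ n)%:E *
   \int[product_measure_rV m1']_v \int[product_measure_rV m2']_w F (v, w))%E.
Proof.
move=> dom; apply: le_trans (shear_rV_le C0 dom mF F0).
rewrite le_eqVlt; apply/orP; left; apply/eqP.
by apply: eq_integral => v _; apply: eq_integral => w _; rewrite scale1r.
Qed.

Lemma scale_rV_le (b : R) :
  (forall i, shear_dominated 0 b C (m1 i) (m2 i) (m1' i) (m2' i)) ->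
  (\int[product_measure_rV m1]_v \int[product_measure_rV m2]_w
      F (v, b *: w)%R <=
   (C ^+ n)%:E *
   \int[product_measure_rV m1']_v \int[product_measure_rV m2']_w F (v, w))%E.
Proof.
move=> dom; apply: le_trans (shear_rV_le C0 dom mF F0).
rewrite le_eqVlt; apply/orP; left; apply/eqP.
by apply: eq_integral => v _; apply: eq_integral => w _; rewrite scale0r addr0.
Qed.

End shear_rV_special.

Section normal_rV.
Context {R : realType}.
Local Notation RM := (measurableTypeR R).

Lemma lebesgue_density_normal (m s : R) :
  lebesgue_density (normal_prob m s) (normal_pdf m s).
Proof.
split; [exact: measurable_normal_pdf|exact: normal_pdf_ge0|].
by move=> f mf f0; exact: ge0_integral_normal.
Qed.

Lemma lebesgue_density_lebesgue :
  lebesgue_density (@lebesgue_measure R) (fun=> 1).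
Proof.
by split => // f mf f0; apply: eq_integral => x _; rewrite mule1.
Qed.

Lemma normal_rV_shear_le n (mu : 'rV[R]_n) (v a c : R)
    (F : 'rV[R]_n * 'rV[R]_n -> \bar R) : 0 < v -> 0 < a -> c ^+ 2 <= a / 2 ->
  measurable_fun setT F -> (forall x, 0 <= F x)%E ->
  (\int[normal_rV mu v]_y \int[normal_rV 0 v]_w F (y + c *: w, w)%R <=
   (shear_const a ^+ n)%:E *
   \int[normal_rV mu ((1 + a) * v)]_z \int[normal_rV 0 (2 * v)]_w F (z, w))%E.
Proof.
move=> v0 a0 ca mF F0.
apply: translate_rV_le => //; first by rewrite mulr_ge0// sqrtr_ge0.
move=> i G mG G0; rewrite mxE.
apply: (@shear_1d_le _ _ _ _ _ _ _ _ _ (lebesgue_density_normal _ _)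
  (lebesgue_density_normal _ _) (lebesgue_density_normal _ _)
  (lebesgue_density_normal _ _)) => //.
  by rewrite mulr_ge0// sqrtr_ge0.
move=> z w; rewrite divr1 invr1 mul1r normr1 mul1r.
exact: normal_pdf_shear_le.
Qed.

(** Normal densities are bounded, so the law of (Y, b W) is dominated by Lebesgue
    measure; only null sets matter in the use made of it. *)
Lemma normal_rV_scale_le n (mu : 'rV[R]_n) (v b : R)
    (F : 'rV[R]_n * 'rV[R]_n -> \bar R) : 0 < v -> b != 0 ->
  measurable_fun setT F -> (forall x, 0 <= F x)%E ->
  (\int[normal_rV mu v]_y \int[normal_rV 0 v]_w F (y, b *: w)%R <=
   ((normal_peak (Num.sqrt v) ^+ 2 / `|b|) ^+ n)%:E *
   \int[lebesgue_rV n]_z \int[lebesgue_rV n]_w F (z, w))%E.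
Proof.
move=> v0 b0 mF F0.
have C0 : 0 <= normal_peak (Num.sqrt v) ^+ 2 / `|b|.
  by rewrite divr_ge0// sqr_ge0.
apply: scale_rV_le => //.
move=> i G mG G0; rewrite mxE.
apply: (@shear_1d_le _ _ _ _ _ _ _ _ _ (lebesgue_density_normal _ _)
  (lebesgue_density_normal _ _) lebesgue_density_lebesgue
  lebesgue_density_lebesgue) => //.
move=> z w; rewrite !mulr1 [leRHS]mulrC divfK ?normr_eq0// expr2.
by apply: ler_pM; rewrite ?normal_pdf_ge0// normal_pdf_sqrt_le.
Qed.

End normal_rV.

(** * Square integrability, laws, and independent pairs *)

Section square_integrable.
Context {d : measure_display} {T : measurableType d} {R : realType}.
Variable Q : probability T R.
Implicit Type f : T -> R.

Lemma integral_prob_cst (c : R) : (\int[Q]_x c%:E = c%:E)%E.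
Proof.
rewrite integral_cst//= [X in (_ * X)%E](_ : _ = 1%E) ?mule1//.
exact: (@probability_setT _ _ _ Q).
Qed.

Lemma integrable_prob_cst (c : R) : Q.-integrable setT (fun=> c%:E).
Proof.
apply/integrableP; split => //.
by under eq_integral do rewrite abse_EFin; rewrite integral_prob_cst ltry.
Qed.

Lemma ge0_integrable f : measurable_fun setT f -> (forall x, 0 <= f x) ->
  (\int[Q]_x (f x)%:E < +oo)%E -> Q.-integrable setT (EFin \o f).
Proof.
move=> mf f0 foo; apply/integrableP; split; first exact/measurable_EFinP.
by under eq_integral do rewrite /= ger0_norm//.
Qed.

Lemma square_integrable f : measurable_fun setT f ->
  (\int[Q]_x (f x ^+ 2)%:E < +oo)%E -> Q.-integrable setT (EFin \o f).
Proof.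
move=> mf foo.
have mf2 : measurable_fun setT (fun x => f x ^+ 2) by exact: measurable_funX.
have int2 := ge0_integrable mf2 (fun=> sqr_ge0 _) foo.
apply: (le_integrable _ _ _ (integrableD _ (integrable_prob_cst 1) int2)) => //.
  exact/measurable_EFinP.
move=> x _; rewrite /= lee_fin [leRHS]ger0_norm ?addr_ge0 ?sqr_ge0//.
rewrite -[f x ^+ 2]real_normK ?num_real//.
by have := sqr_ge0 (`|f x| - 1); have := normr_ge0 (f x); nra.
Qed.

(** The bias-variance identity; it yields both the minimality of the mean among
    constants and the bound on the variance by the second moment. *)
Lemma integral_sqr_shift f c : measurable_fun setT f ->
  (\int[Q]_x (f x ^+ 2)%:E < +oo)%E ->
  (\int[Q]_x ((f x - c) ^+ 2)%:E = \int[Q]_x (f x ^+ 2)%:E +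
    (c ^+ 2 - 2 * c * fine (\int[Q]_x (f x)%:E))%:E)%E.
Proof.
move=> mf foo.
have mf2 : measurable_fun setT (fun x => f x ^+ 2) by exact: measurable_funX.
have int2 := ge0_integrable mf2 (fun=> sqr_ge0 _) foo.
have int1 := square_integrable mf foo.
have fin1 := integrable_fin_num measurableT int1.
under eq_integral => x _.
  rewrite (_ : _%:E = ((f x ^+ 2)%:E + ((- (2 * c))%:E * (f x)%:E + (c ^+ 2)%:E))%E); first over.
  by rewrite -EFinM -!EFinD; congr EFin; ring.
have int3 : Q.-integrable setT (fun x => (- (2 * c))%:E * (f x)%:E)%E.
  exact: integrableZl.
rewrite integralD//=; last exact: integrableD (integrable_prob_cst _).
rewrite integralD//=; last exact: integrable_prob_cst.
rewrite integralZl// integral_prob_cst; congr (_ + _)%E.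
by rewrite -[X in (_ * X + _)%E]fineK// -EFinM -EFinD; congr EFin; ring.
Qed.

End square_integrable.

Section has_law.
Context {d d' : measure_display} {T : measurableType d} {T' : measurableType d'}
  {R : realType}.
Variables (P : probability T R) (X : {RV P >-> T'}).

Lemma integrable_distribution (f : T' -> \bar R) :
  (distribution P X).-integrable setT f -> P.-integrable setT (f \o X).
Proof.
move=> /integrableP[mf foo]; apply/integrableP; split.
  exact: measurableT_comp.
rewrite /= -(ge0_integral_distribution X (f := fun y => `|f y|%E))//.
exact: measurableT_comp.
Qed.

Lemma integral_distribution_set (f : T' -> \bar R) B : measurable B ->
  (distribution P X).-integrable setT f ->
  (\int[P]_(w in X @^-1` B) f (X w) = \int[distribution P X]_(y in B) f y)%E.
Proof.
move=> mB intf; rewrite integral_pushforward//; first exact: measurable_int intf.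
apply: integrableS (integrable_distribution intf) => //.
by rewrite -[X in measurable X]setTI; exact: measurable_funPT.
Qed.

Lemma ge0_integral_has_law (m : {measure set T' -> \bar R}) (f : T' -> \bar R) :
  has_law P X m -> measurable_fun setT f -> (forall x, 0 <= f x)%E ->
  (\int[P]_w f (X w) = \int[m]_x f x)%E.
Proof.
move=> XP mf f0; rewrite -[LHS](ge0_integral_distribution X mf f0).
by apply: eq_measure_integral => A mA _; exact: XP.
Qed.

End has_law.

Section independent_pair.
Context {d d1 d2 : measure_display} {T : measurableType d}
  {T1 : measurableType d1} {T2 : measurableType d2} {R : realType}.
Variables (P : probability T R) (Y : {RV P >-> T1}) (W : {RV P >-> T2}).
Hypothesis indep : independent_rv P Y W.
Local Notation PY := (distribution P Y).
Local Notation PW := (distribution P W).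

Let mYW : measurable_fun setT (fun w => (Y w, W w)).
Proof. exact: measurable_fun_pair. Qed.

Lemma product_distribution A : measurable A ->
  (PY \x PW)%E A = image_measure P mYW A.
Proof. by apply: product_measure_unique => B C mB mC; exact: indep. Qed.

Lemma ge0_integral_indep (f : T1 * T2 -> \bar R) : measurable_fun setT f ->
  (forall x, 0 <= f x)%E ->
  (\int[P]_w f (Y w, W w) = \int[PY]_y \int[PW]_v f (y, v))%E.
Proof.
move=> mf f0; rewrite -(@fubini_tonelli1 _ _ _ _ _ PY PW f mf f0).
rewrite -(ge0_integral_image_measure P mYW mf f0).
by apply: eq_measure_integral => A mA _; exact/esym/product_distribution.
Qed.

Lemma integrable_indep (f : T1 * T2 -> \bar R) :
  (PY \x PW)%E.-integrable setT f -> P.-integrable setT (fun w => f (Y w, W w)).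
Proof.
move=> intf; have /integrableP[mf _] := intf; apply/integrableP; split.
  exact: (measurableT_comp mf mYW).
move/(integrable12ltyP _ _ mf) : intf.
rewrite (ge0_integral_indep (f := fun x => `|f x|%E))//.
exact: measurableT_comp.
Qed.

Lemma integral_indep (f : T1 * T2 -> \bar R) : (PY \x PW)%E.-integrable setT f ->
  (\int[P]_w f (Y w, W w) = \int[PY]_y \int[PW]_v f (y, v))%E.
Proof.
move=> intf; rewrite (integral12_prod_meas1 intf).
have mf := measurable_int _ intf.
rewrite -(integral_pushforward mYW mf _ measurableT); last first.
  exact: integrable_indep.
by apply: eq_measure_integral => A mA _; exact/esym/product_distribution.
Qed.

Variable F : T1 * T2 -> R.
Hypothesis mF : measurable_fun setT F.

(** By independence, a version of the conditional expectation of F(Y, W) given Y is a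
    function of Y. [fine] gives it the value 0 where the integral is infinite. *)
Definition regression (y : T1) : R := fine (\int[PW]_v (F (y, v))%:E)%E.

Section regression.
Hypothesis intF : P.-integrable setT (fun w => (F (Y w, W w))%:E).

Lemma integrable_product_distribution : (PY \x PW)%E.-integrable setT (EFin \o F).
Proof.
have mEF : measurable_fun setT (EFin \o F) by exact/measurable_EFinP.
apply/integrable12ltyP => //.
have /integrableP[_] := intF.
rewrite (ge0_integral_indep (f := fun x => `|(F x)%:E|%E))//.
exact: measurableT_comp.
Qed.

Lemma measurable_regression : measurable_fun setT regression.
Proof.
apply: measurableT_comp => //.
exact: measurable_fubini_F integrable_product_distribution.
Qed.

Lemma integrable_regression : PY.-integrable setT (EFin \o regression).
Proof.
have := integrable_fubini_F integrable_product_distribution.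
apply: le_integrable => //; first exact/measurable_EFinP/measurable_regression.
move=> y _; rewrite /= /regression.
by rewrite /fubini_F /=; case: (\int[PW]_v _)%E => [r| |] //=; rewrite normr0 leey.
Qed.

(** Fubini on B x setT for the product law of (Y, W); the regression function equals
    the inner integral only almost everywhere. *)
Lemma is_cond_exp_regression :
  is_cond_exp P Y (fun w => F (Y w, W w)) (regression \o Y).
Proof.
have mR := measurable_regression.
have intR := integrable_regression.
split => //.
- exact: (integrable_distribution intR).
- move=> _ B mB; exists (regression @^-1` B).
    by rewrite -[X in measurable X]setTI; exact: mR.
  by rewrite !setTI.
- move=> _ [B mB <-]; rewrite setTI.
  rewrite (integral_distribution_set mB intR).
  transitivity (\int[PY]_(y in B) \int[PW]_v (F (y, v))%:E)%E.
    have intG := integrable_fubini_F integrable_product_distribution.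
    apply: ae_eq_integral => //.
    - by apply/measurable_EFinP; exact: measurable_funTS.
    - exact: measurable_funTS (measurable_int _ intG).
    - have := integrable_ae measurableT intG; apply: filterS => y /(_ Logic.I) yfin _.
      by rewrite /= /regression fineK.
  have intFB : (PY \x PW)%E.-integrable setT ((EFin \o F) \_ (B `*` setT)).
    apply/(integrable_mkcond _ _).1; first exact: measurableX.
    apply: (integrableS measurableT) integrable_product_distribution => //.
    exact: measurableX.
  rewrite [RHS]integral_mkcond [LHS]integral_mkcond.
  transitivity (\int[P]_w ((EFin \o F) \_ (B `*` setT)) (Y w, W w))%E; last first.
    apply: eq_integral => w _; rewrite !patchE /=; congr (if _ then _ else _).
    by apply/idP/idP => /set_mem YB; apply/mem_set; [case: YB|split].
  rewrite (integral_indep intFB); apply: eq_integral => y _; rewrite patchE.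
  case: ifPn => yB.
    apply: eq_integral => v _; rewrite patchE mem_set//; split => //.
    exact: set_mem.
  rewrite integral0_eq// => v _; rewrite patchE memNset// => -[/= yB' _].
  by move/negP: yB; apply; exact/mem_set.
Qed.

End regression.
End independent_pair.

(** * Conditional variance given one member of an independent pair *)

Section cond_exp_unique.
Context {d d' : measure_display} {T : measurableType d} {T' : measurableType d'}
  {R : realType}.
Variables (P : probability T R) (Y : {RV P >-> T'}).
Implicit Types X h : T -> R.

Lemma g_sigma_algebra_preimage_measurable (A : set T) :
  g_sigma_algebra_preimage Y A -> measurable A.
Proof. by move=> [B mB <-]; exact: measurable_funP. Qed.

(** The set where h1 > h2 belongs to the sigma-algebra of Y, and the positive
    function h1 - h2 has integral zero on it. *)
Lemma cond_exp_le X h1 h2 : is_cond_exp P Y X h1 -> is_cond_exp P Y X h2 ->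
  {ae P, forall w, h1 w <= h2 w}.
Proof.
move=> [_ int1 m1 e1] [_ int2 m2 e2].
pose D := [set w | h2 w < h1 w].
have D_Y : g_sigma_algebra_preimage Y D.
  have := measurable_fun_ltr m2 m1.
  move=> /(_ measurableT [set true] Logic.I); rewrite setTI.
  by congr (g_sigma_algebra_preimage Y _); apply/seteqP; split => w.
have mD := g_sigma_algebra_preimage_measurable D_Y.
have int12 : P.-integrable D (fun w => (h1 w - h2 w)%:E).
  under eq_fun do rewrite EFinB.
  by apply: (integrableS measurableT) => //; exact: integrableB.
have : (\int[P]_(w in D) `|(h1 w - h2 w)%:E| = 0)%E.
  transitivity (\int[P]_(w in D) ((h1 w)%:E - (h2 w)%:E))%E.
    apply: eq_integral => w /set_mem; rewrite /D /= => h21.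
    by rewrite ger0_norm ?EFinB// subr_ge0 ltW.
  rewrite integralB//; [|exact: (integrableS measurableT)..].
  rewrite e1// e2// subee//.
  rewrite -e1//; apply: integrable_fin_num => //.
  exact: (integrableS measurableT).
move/(ae_eq_integral_abs P mD (measurable_int _ int12)).
apply: filterS => w h; rewrite leNgt; apply/negP => h21.
have := h h21 => -[] /eqP; rewrite subr_eq0 => /eqP E.
by move: h21; rewrite E ltxx.
Qed.

Lemma cond_exp_unique X h1 h2 : is_cond_exp P Y X h1 -> is_cond_exp P Y X h2 ->
  {ae P, forall w, h1 w = h2 w}.
Proof.
move=> c1 c2; have := cond_exp_le c1 c2; have := cond_exp_le c2 c1.
by apply: filterS2 => w h21 h12; apply/eqP; rewrite eq_le h12.
Qed.

Lemma is_cond_exp_ae_eq X X' h : measurable_fun setT X' ->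
  {ae P, forall w, X w = X' w} -> is_cond_exp P Y X h -> is_cond_exp P Y X' h.
Proof.
move=> mX' XX' [intX inth mh e].
have mX := measurable_int _ intX.
have mEX' : measurable_fun setT (EFin \o X') by exact/measurable_EFinP.
have aeE : ae_eq P setT (EFin \o X) (EFin \o X').
  by apply: filterS XX' => w /= -> _.
split => //.
- apply/integrableP; split => //.
  have /integrableP[_] := intX; congr (_ < _)%E.
  apply: ge0_ae_eq_integral => //; do ?exact: measurableT_comp.
  by apply: filterS aeE => w /[apply] ->.
- move=> A A_Y; rewrite e//.
  have mA := g_sigma_algebra_preimage_measurable A_Y.
  apply: ae_eq_integral => //; do ?exact: measurable_funTS.
  by apply: filterS XX' => w /= -> _.
Qed.

Lemma cond_expP X h : is_cond_exp P Y X h -> is_cond_exp P Y X (cond_exp P Y X).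
Proof. by move=> ?; apply: (xgetPex (cst 0)); exists h. Qed.

Lemma integral_cond_exp X h : is_cond_exp P Y X h ->
  (\int[P]_w (h w)%:E = \int[P]_w (X w)%:E)%E.
Proof. by move=> [_ _ _]; apply; exists setT => //; rewrite setTI preimage_setT. Qed.

End cond_exp_unique.

Section cond_var_indep.
Context {d d1 d2 : measure_display} {T : measurableType d}
  {T1 : measurableType d1} {T2 : measurableType d2} {R : realType}.
Variables (P : probability T R) (Y : {RV P >-> T1}) (W : {RV P >-> T2}).
Hypothesis indep : independent_rv P Y W.
Local Notation PY := (distribution P Y).
Local Notation PW := (distribution P W).
Variable F : T1 * T2 -> R.
Hypothesis mF : measurable_fun setT F.
Hypothesis F2_lty : (\int[P]_w (F (Y w, W w) ^+ 2)%:E < +oo)%E.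
Local Notation X := (fun w => F (Y w, W w)).
Local Notation H := (regression W F).

Let mX : measurable_fun setT X.
Proof. by apply: (measurableT_comp mF); exact: measurable_fun_pair. Qed.

Let intX : P.-integrable setT (EFin \o X).
Proof. exact: square_integrable. Qed.

Let mH : measurable_fun setT H.
Proof. exact: measurable_regression intX. Qed.

Let dev (yv : T1 * T2) : R := (F yv - H yv.1) ^+ 2.

Let mdev : measurable_fun setT dev.
Proof.
apply: measurable_funX; apply: measurable_funB => //.
exact: (measurableT_comp mH).
Qed.

Let mF2 : measurable_fun setT (fun yv => (F yv ^+ 2)%:E).
Proof. by apply/measurable_EFinP; exact: measurable_funX. Qed.

Let F20 (yv : T1 * T2) : (0 <= (F yv ^+ 2)%:E)%E.
Proof. by rewrite lee_fin sqr_ge0. Qed.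

Let mEdev : measurable_fun setT (fun yv => (dev yv)%:E).
Proof. exact/measurable_EFinP. Qed.

Let dev0 yv : (0 <= (dev yv)%:E)%E.
Proof. by rewrite lee_fin sqr_ge0. Qed.

(** For fixed y, E (F - E F)^2 = E F^2 - (E F)^2; where F(y, .) is not square
    integrable the right-hand side is infinite. *)
Lemma integral_dev_le :
  (\int[P]_w (dev (Y w, W w))%:E <= \int[P]_w (X w ^+ 2)%:E)%E.
Proof.
rewrite (ge0_integral_indep indep (f := fun yv => (dev yv)%:E) mEdev dev0).
rewrite (ge0_integral_indep indep (f := fun yv => (F yv ^+ 2)%:E) mF2 F20).
apply: ge0_le_integral => //.
- by move=> y _; apply: integral_ge0.
- exact: (@measurable_fun_fubini_tonelli_F _ _ _ _ _ PW _ mEdev dev0).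
- exact: (@measurable_fun_fubini_tonelli_F _ _ _ _ _ PW _ mF2 F20).
move=> y _.
have [->|] := eqVneq (\int[PW]_v (F (y, v) ^+ 2)%:E)%E +oo%E; first by rewrite leey.
rewrite -ltey => oo.
have mFy : measurable_fun setT (fun v => F (y, v)) by exact: (measurable_fun_pair2 y mF).
rewrite (integral_sqr_shift (H y) mFy oo) -/(H y).
rewrite -[leRHS]adde0 leeD2l// lee_fin.
by have := sqr_ge0 (H y); nra.
Qed.

(** The chosen version of the conditional expectation agrees almost surely with the
    regression function, which replaces the squared deviation by a function of the
    pair (Y, W), to which the same existence result applies again. *)
Lemma cond_var_indepE : cond_var_defined P Y X /\
  ('E_P[cond_var P Y X] = \int[P]_w (dev (Y w, W w))%:E)%E.
Proof.
have cX := is_cond_exp_regression indep mF intX.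
have ce := cond_expP cX.
have [_ inth _ _] := ce.
have intdev : P.-integrable setT (fun w => (dev (Y w, W w))%:E).
  apply: ge0_integrable.
  - by apply: (measurableT_comp mdev); exact: measurable_fun_pair.
  - by move=> w; exact: sqr_ge0.
  - exact: le_lt_trans integral_dev_le F2_lty.
have cdev := is_cond_exp_regression indep mdev intdev.
have msq : measurable_fun setT (sq_dev P Y X).
  apply: measurable_funX; apply: measurable_funB => //.
  by apply/measurable_EFinP; exact: (measurable_int _ inth).
have ae_dev : {ae P, forall w, dev (Y w, W w) = sq_dev P Y X w}.
  have := cond_exp_unique cX ce; apply: filterS => w.
  by rewrite /dev /sq_dev /= => ->.
have csq := is_cond_exp_ae_eq msq ae_dev cdev.
split; first by split => //; exact: cond_expP csq.
rewrite unlock (integral_cond_exp (cond_expP csq)).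
rewrite -(integral_cond_exp csq) (integral_cond_exp cdev)//.
Qed.

Lemma cond_var_le : ('E_P[cond_var P Y X] <= \int[P]_w (X w ^+ 2)%:E)%E.
Proof. by rewrite cond_var_indepE.2 integral_dev_le. Qed.

(** (M - h)^2 <= 2 (F - h)^2 + 2 N^2 for every h. With h the conditional mean of F,
    a function of Y, the mean of the left-hand side is at least that of M^2 because M
    has conditional mean zero. *)
Lemma cond_var_ge (M N : T1 * T2 -> R) : measurable_fun setT M ->
  measurable_fun setT N -> (forall yv, F yv = M yv + N yv) ->
  (forall y, \int[PW]_v (M (y, v) ^+ 2)%:E < +oo)%E ->
  (forall y, \int[PW]_v (M (y, v))%:E = 0)%E ->
  (\int[P]_w (M (Y w, W w) ^+ 2)%:E <=
   2%:E * 'E_P[cond_var P Y X] + 2%:E * \int[P]_w (N (Y w, W w) ^+ 2)%:E)%E.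
Proof.
move=> mM mN FE M2 M0; rewrite cond_var_indepE.2.
have m2 (G : T1 * T2 -> R) : measurable_fun setT G ->
    measurable_fun setT (fun yv => (G yv ^+ 2)%:E).
  by move=> mG; apply/measurable_EFinP; exact: measurable_funX.
have ge2 (G : T1 * T2 -> R) yv : (0 <= (G yv ^+ 2)%:E)%E by rewrite lee_fin sqr_ge0.
pose A yv : R := M yv - H yv.1.
have mA : measurable_fun setT A.
  by apply: measurable_funB => //; exact: (measurableT_comp mH).
apply: (@le_trans _ _ (\int[P]_w (A (Y w, W w) ^+ 2)%:E)%E).
  rewrite (ge0_integral_indep indep (m2 _ mM) (ge2 M)).
  rewrite (ge0_integral_indep indep (m2 _ mA) (ge2 A)).
  apply: ge0_le_integral => //.
  - by move=> y _; apply: integral_ge0.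
  - exact: (@measurable_fun_fubini_tonelli_F _ _ _ _ _ PW _ (m2 _ mM) (ge2 M)).
  - exact: (@measurable_fun_fubini_tonelli_F _ _ _ _ _ PW _ (m2 _ mA) (ge2 A)).
  move=> y _; rewrite (integral_sqr_shift (H y) (measurable_fun_pair2 y mM) (M2 y)).
  rewrite leeDl// M0 lee_fin /= mulr0 subr0; exact: sqr_ge0.
have mY2 (G : T1 * T2 -> R) : measurable_fun setT G ->
    measurable_fun setT (fun w => (G (Y w, W w) ^+ 2)%:E).
  by move=> mG; apply: (measurableT_comp (m2 _ mG)); exact: measurable_fun_pair.
have mYdev : measurable_fun setT (fun w => (dev (Y w, W w))%:E).
  by apply: (measurableT_comp mEdev); exact: measurable_fun_pair.
rewrite -!ge0_integralZl//; last exact: mY2.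
rewrite -ge0_integralD//; last 4 first.
- by move=> w _; rewrite mule_ge0.
- exact: emeasurable_funM.
- by move=> w _; rewrite mule_ge0.
- by apply: emeasurable_funM => //; exact: mY2.
apply: ge0_le_integral => //.
- exact: mY2.
- by apply: emeasurable_funD; apply: emeasurable_funM => //; exact: mY2.
move=> w _; rewrite -!EFinM -EFinD lee_fin /A /dev FE /=.
set m := M _; set nn := N _; set h := H _.
by have := sqr_ge0 (m - h + nn *+ 2); nra.
Qed.

End cond_var_indep.

(** * Coordinates of normal vectors and Euclidean norms *)

Section normal_coordinates.
Context {R : realType}.
Local Notation RM := (measurableTypeR R).
Variables (n : nat) (mu : 'rV[R]_n) (v : R).
Local Notation N i := (normal_prob (mu 0 i) (Num.sqrt v)).

Lemma normal_rV_coord i (A : set RM) : measurable A ->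
  normal_rV mu v [set w | A (w 0 i)] = N i A.
Proof.
move=> mA; pose B k := if k == i then A else setT.
transitivity (normal_rV mu v [set w : 'rV[R]_n | forall k, B k (w 0 k)]).
  congr (normal_rV mu v _).
  apply/seteqP; split => w /=.
    by move=> Aw k; rewrite /B; case: eqP => [->|].
  by move=> /(_ i); rewrite /B eqxx.
rewrite product_measure_rVE; last by move=> k; rewrite /B; case: ifP.
rewrite (bigD1 i)//= /B eqxx big1 ?mule1// => k /negbTE ->.
exact: (@probability_setT _ _ _ (N k)).
Qed.

Lemma normal_rV_coord2 i j (A B : set RM) : i != j -> measurable A -> measurable B ->
  normal_rV mu v [set w | A (w 0 i) /\ B (w 0 j)] = (N i A * N j B)%E.
Proof.
move=> ij mA mB; pose D k := if k == i then A else if k == j then B else setT.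
transitivity (normal_rV mu v [set w : 'rV[R]_n | forall k, D k (w 0 k)]).
  congr (normal_rV mu v _).
  apply/seteqP; split => w /=.
    by move=> [Aw Bw] k; rewrite /D; case: eqP => [->|_] //; case: eqP => [->|].
  by move=> Dw; split; [have := Dw i|have := Dw j]; rewrite /D eqxx// eq_sym (negbTE ij).
rewrite product_measure_rVE; last by move=> k; rewrite /D; case: ifP => // _; case: ifP.
rewrite (bigD1 i)//= (bigD1 j)//=; last by rewrite eq_sym.
have -> : D i = A by rewrite /D eqxx.
have -> : D j = B by rewrite /D eq_sym (negbTE ij) eqxx.
congr (_ * _)%E; rewrite -[RHS]mule1; congr (_ * _)%E.
apply: big1; rewrite /D.
move=> k /andP[/negbTE -> /negbTE ->].
exact: (@probability_setT _ _ _ (N k)).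
Qed.

Lemma ge0_integral_normal_rV_coord i (f : RM -> \bar R) : measurable_fun setT f ->
  (forall x, 0 <= f x)%E ->
  (\int[normal_rV mu v]_w f (w 0%R i) = \int[N i]_x f x)%E.
Proof.
move=> mf f0.
rewrite -(@ge0_integral_image_measure _ _ _ RM _ (normal_rV mu v) _ (measurable_entry 0 i) f)//.
by apply: eq_measure_integral => A mA _; exact: normal_rV_coord.
Qed.

Lemma normal_rV_setT : normal_rV mu v setT = 1%E.
Proof.
transitivity (normal_rV mu v [set w : 'rV[R]_n | forall k, [set: RM] (w 0 k)]).
  congr (normal_rV mu v _).
  by apply/seteqP; split.
rewrite /normal_rV (product_measure_rVE _ (A := fun=> setT))// big1// => k _.
exact: (@probability_setT _ _ _ (N k)).
Qed.

End normal_coordinates.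

Section euclidean.
Context {R : realType}.
Implicit Types n K : nat.

Lemma sqr_sum_le n (a : 'I_n -> R) :
  (\sum_i a i) ^+ 2 <= n%:R * \sum_i a i ^+ 2.
Proof.
rewrite expr2 mulr_suml.
under eq_bigr do rewrite mulr_sumr.
have -> : n%:R * \sum_i a i ^+ 2 = \sum_i \sum_j (a i ^+ 2 + a j ^+ 2) / 2.
  transitivity (\sum_i (n%:R * a i ^+ 2 + \sum_j a j ^+ 2) / 2).
    rewrite -mulr_suml big_split/= -mulr_sumr sumr_const card_ord -mulr_natl.
    by field.
  apply: eq_bigr => i _; rewrite -mulr_suml; congr (_ / _).
  by rewrite big_split/= sumr_const card_ord mulr_natl.
apply: ler_sum => i _; apply: ler_sum => j _.
by have := sqr_ge0 (a i - a j); nra.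
Qed.

Lemma dotv_sqr_le n (u w : 'rV[R]_n) :
  dotv u w ^+ 2 <= (\sum_j u 0 j ^+ 2) * (\sum_j w 0 j ^+ 2).
Proof.
rewrite /dotv expr2 mulr_suml.
under eq_bigr do rewrite mulr_sumr.
rewrite [leRHS](_ : _ = \sum_i \sum_j (u 0 i ^+ 2 * w 0 j ^+ 2 + u 0 j ^+ 2 * w 0 i ^+ 2) / 2).
  apply: ler_sum => i _; apply: ler_sum => j _.
  by have := sqr_ge0 (u 0 i * w 0 j - u 0 j * w 0 i); nra.
apply/esym; under eq_bigr do under eq_bigr do rewrite mulrDl.
under eq_bigr do rewrite big_split/=.
rewrite big_split/= [X in _ + X = _]exchange_big/= -mulr2n.
rewrite mulr_suml -sumrMnl; apply: eq_bigr => i _.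
rewrite mulr_sumr -sumrMnl; apply: eq_bigr => j _.
by field.
Qed.

Lemma l2norm_sqr m n (A : 'M[R]_(m, n)) : l2norm A ^+ 2 = \sum_i \sum_j A i j ^+ 2.
Proof.
by rewrite sqr_sqrtr// sumr_ge0// => i _; rewrite sumr_ge0// => j _; exact: sqr_ge0.
Qed.

Lemma l2norm_rV_sqr n (u : 'rV[R]_n) : l2norm u ^+ 2 = \sum_j u 0 j ^+ 2.
Proof. by rewrite l2norm_sqr big_ord1. Qed.

Lemma l2norm_pow4_le n (u : 'rV[R]_n) : l2norm u ^+ 4 <= n%:R * \sum_j u 0 j ^+ 4.
Proof.
rewrite (_ : l2norm u ^+ 4 = (l2norm u ^+ 2) ^+ 2); last by rewrite -exprM.
rewrite l2norm_rV_sqr; apply: le_trans (sqr_sum_le _) _.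
rewrite le_eqVlt; apply/orP; left; apply/eqP; congr (_ * _).
by apply: eq_bigr => j _; rewrite -exprM.
Qed.

Lemma l2norm_sqrB_le n (u w : 'rV[R]_n) :
  l2norm (u - w) ^+ 2 <= 2 * l2norm u ^+ 2 + 2 * l2norm w ^+ 2.
Proof.
rewrite !l2norm_rV_sqr !mulr_sumr -big_split/=; apply: ler_sum => i _.
rewrite !mxE; by have := sqr_ge0 (u 0 i + w 0 i); nra.
Qed.

Lemma l2norm_pow4B_le n (u w : 'rV[R]_n) :
  l2norm (u - w) ^+ 4 <= 8 * l2norm u ^+ 4 + 8 * l2norm w ^+ 4.
Proof.
have := l2norm_sqrB_le u w.
have e4 (x : R) : x ^+ 4 = (x ^+ 2) ^+ 2 by rewrite -exprM.
rewrite !e4.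
have := sqr_ge0 (l2norm (u - w)); have := sqr_ge0 (l2norm u); have := sqr_ge0 (l2norm w).
set a := l2norm _ ^+ 2; set b := l2norm _ ^+ 2; set c := l2norm _ ^+ 2 => c0 b0 a0 h.
have h2 : a ^+ 2 <= (2 * b + 2 * c) ^+ 2.
  by rewrite lerXn2r ?nnegrE// addr_ge0// mulr_ge0.
by have := sqr_ge0 (b - c); nra.
Qed.

Lemma measurable_l2norm m n : measurable_fun setT (@l2norm R m n).
Proof.
apply: measurableT_comp; first exact: (continuous_measurable_fun (@sqrt_continuous R)).
apply: measurable_sum => i; apply: measurable_sum => j.
by apply: measurable_funX; exact: measurable_entry.
Qed.

Lemma measurable_l2normT d (T : measurableType d) m n (f : T -> 'M[R]_(m, n)) :
  measurable_fun setT f -> measurable_fun setT (fun t => l2norm (f t)).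
Proof. exact: (measurableT_comp (@measurable_l2norm m n)). Qed.

Lemma measurable_dotv d (T : measurableType d) n (f h : T -> 'rV[R]_n) :
  measurable_fun setT f -> measurable_fun setT h ->
  measurable_fun setT (fun t => dotv (f t) (h t)).
Proof.
move=> mf mh; apply: measurable_sum => j; apply: measurable_funM.
  exact: (measurableT_comp (measurable_entry 0 j) mf).
exact: (measurableT_comp (measurable_entry 0 j) mh).
Qed.

Lemma measurable_rV_B d (T : measurableType d) n (f h : T -> 'rV[R]_n) :
  measurable_fun setT f -> measurable_fun setT h ->
  measurable_fun setT (fun t => f t - h t).
Proof.
move=> mf mh; under eq_fun do rewrite -scaleN1r.
by apply: measurable_rV_D => //; exact: measurable_rV_Z.
Qed.

Lemma normal_rV_l2norm4_lty n (mu : 'rV[R]_n) (v : R) : 0 < v ->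
  (\int[normal_rV mu v]_w (l2norm w ^+ 4)%:E < +oo)%E.
Proof.
move=> v0.
have mw4 (j : 'I_n) : measurable_fun setT (fun w : 'rV[R]_n => (w 0 j ^+ 4)%:E).
  apply/measurable_EFinP; apply: measurable_funX.
  exact: (@measurable_entry _ (measurableTypeR R) 1 n 0 j).
have w40 (w : 'rV[R]_n) j : 0 <= w 0 j ^+ 4 by exact: exprn_even_ge0.
apply: (@le_lt_trans _ _ (\int[normal_rV mu v]_w
    (n%:R%:E * \sum_j (w 0%R j ^+ 4)%:E))%E).
  apply: ge0_le_integral => //.
  - by move=> w _; rewrite lee_fin exprn_even_ge0.
  - by apply/measurable_EFinP; apply: measurable_funX; exact: measurable_l2norm.
  - by apply: emeasurable_funM => //; exact: emeasurable_sum.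
  - by move=> w _; rewrite sumEFin -EFinM lee_fin l2norm_pow4_le.
rewrite ge0_integralZl//; last 2 first.
- exact: emeasurable_sum.
- by move=> w _; rewrite sumEFin lee_fin sumr_ge0.
rewrite ge0_integral_sum//; last by move=> j w _; rewrite lee_fin.
apply: lte_mul_pinfty => //.
apply: lte_sum_pinfty => j _.
rewrite (ge0_integral_normal_rV_coord mu v j (f := fun x => (x ^+ 4)%:E)).
- by apply: integral_normal_pow4_lty; rewrite sqrtr_gt0.
- by apply/measurable_EFinP; exact: measurable_funX.
- by move=> x; rewrite lee_fin exprn_even_ge0.
Qed.

End euclidean.

(** * Increments of weakly differentiable maps *)

Section jensen.
Context {d : measure_display} {T : measurableType d} {R : realType}.
Variables (m : {measure set T -> \bar R}) (D : set T).
Hypotheses (mD : measurable D) (mD1 : m D = 1%E).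

(** Taking the value u of the integral itself as the weight in the inequality
    2 u |f| <= u^2 + f^2 spares any integrability assumption on f. *)
Lemma sqr_integral_le (f : T -> R) (u : R) : measurable_fun D f ->
  (u%:E = \int[m]_(x in D) (f x)%:E)%E ->
  ((u ^+ 2)%:E <= \int[m]_(x in D) (f x ^+ 2)%:E)%E.
Proof.
move=> mf uE.
have mfa : measurable_fun D (fun x => `|f x|%:E).
  by apply/measurable_EFinP; exact: measurableT_comp.
have mf2 : measurable_fun D (fun x => (f x ^+ 2)%:E).
  by apply/measurable_EFinP; exact: measurable_funX.
have u_le : (`|u|%:E <= \int[m]_(x in D) `|f x|%:E)%E.
  rewrite -abse_EFin uE; apply: le_abse_integral => //.
  exact/measurable_EFinP.
have : ((2 * `|u|)%:E * \int[m]_(x in D) `|f x|%:E <=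
    (u ^+ 2)%:E + \int[m]_(x in D) (f x ^+ 2)%:E)%E.
  rewrite -ge0_integralZl//.
  have -> : (u ^+ 2)%:E = (\int[m]_(x in D) (u ^+ 2)%:E)%E.
    by rewrite integral_cst//= mD1 mule1.
  rewrite -ge0_integralD//; last 2 first.
  - by move=> x _; rewrite lee_fin sqr_ge0.
  - by move=> x _; rewrite lee_fin sqr_ge0.
  apply: ge0_le_integral => //.
  - exact: emeasurable_funM.
  - exact: emeasurable_funD.
  - move=> x _; rewrite -EFinM -EFinD lee_fin.
    rewrite -[u ^+ 2]real_normK ?num_real// -[f x ^+ 2]real_normK ?num_real//.
    by have := sqr_ge0 (`|u| - `|f x|); nra.
move=> h; have {h} : ((2 * `|u|)%:E * `|u|%:E <=
    (u ^+ 2)%:E + \int[m]_(x in D) (f x ^+ 2)%:E)%E.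
  by apply: le_trans h; rewrite lee_wpmul2l// lee_fin mulr_ge0.
have : (0 <= \int[m]_(x in D) (f x ^+ 2)%:E)%E.
  by apply: integral_ge0 => x _; rewrite lee_fin sqr_ge0.
case: (\int[m]_(x in D) (f x ^+ 2)%:E)%E => [r| |]//= _; last by move=> _; rewrite leey.
rewrite -EFinM -EFinD !lee_fin -[u ^+ 2]real_normK ?num_real//.
by have := normr_ge0 u; nra.
Qed.

End jensen.

(** The two features of normal laws that matter are kept as hypotheses: [dom], the
    uniform domination of the law of (Y + c W, W) by a product, and [ac], the
    absolute continuity of the law of (Y, b W). *)
Section difference_quotient.
Context {R : realType}.
Local Notation leb := (@lebesgue_measure R).
Variables (n : nat) (m1 m2 : {sigma_finite_measure set 'rV[R]_n -> \bar R}).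
Variables (m1' m2' : {sigma_finite_measure set 'rV[R]_n -> \bar R}).
Variables (a C : R).
Hypothesis C0 : 0 <= C.
Hypothesis dom : forall (c : R) (F : 'rV[R]_n * 'rV[R]_n -> \bar R),
  c ^+ 2 <= a / 2 -> measurable_fun setT F -> (forall x, 0 <= F x)%E ->
  (\int[m1]_y \int[m2]_w F (y + c *: w, w)%R <=
   C%:E * \int[m1']_z \int[m2']_w F (z, w))%E.
Hypothesis ac : forall (b : R) (Q : 'rV[R]_n * 'rV[R]_n -> Prop), b != 0 ->
  {ae (lebesgue_rV n \x lebesgue_rV n)%E, forall yz, Q yz} ->
  {ae (m1 \x m2)%E, forall yw, Q (yw.1, b *: yw.2)}.
Hypotheses (m2T : m2 setT = 1%E) (m2T' : m2' setT = 1%E).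
Variables (g : 'rV[R]_n -> 'rV[R]_n) (J : 'rV[R]_n -> 'M[R]_n).
Hypotheses (mg : measurable_fun setT g) (mJ : measurable_fun setT J).
Hypothesis gJ : forall i, is_weak_gradient (fun y => g y 0 i) (fun y => row i (J y)).

Let mshift (s : R) : measurable_fun setT
  (fun p : 'rV[R]_n * 'rV[R]_n => p.1 + s *: p.2).
Proof. by apply: measurable_rV_D => //; exact: measurable_rV_Z. Qed.

Let I1 : leb `[0, 1]%classic = 1%E.
Proof. by rewrite lebesgue_measure_itv/= lte01 oppr0 adde0. Qed.

(** The energy of J along the segment from y to y + s w, for p = (y, w). *)
Definition energy (s : R) (p : 'rV[R]_n * 'rV[R]_n) : \bar R :=
  (\int[leb]_(t in `[0%R, 1%R]) (l2norm (J (p.1 + t *: (s *: p.2))) ^+ 2)%:E)%E.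

(** Each coordinate of the increment is the integral over [0, 1] of
    s w . (row i J); Jensen, then Cauchy-Schwarz twice, once in each integrand and once for
    the outer product with w. The factor s^2 compensates the 1 / s^2 in the remainder. *)
Lemma weak_difference_le (s : R) : s != 0 ->
  {ae (m1 \x m2)%E, forall p : 'rV[R]_n * 'rV[R]_n,
    ((dotv p.2 (g (p.1 + s *: p.2) - g p.1) ^+ 2)%:E <=
     (s ^+ 2 * l2norm p.2 ^+ 4)%:E * energy s p)%E}.
Proof.
move=> s0.
have : {ae (m1 \x m2)%E, forall p : 'rV[R]_n * 'rV[R]_n, forall i : 'I_n,
    (g (p.1 + s *: p.2) 0 i - g p.1 0 i)%:E =
    (\int[leb]_(t in `[0%R, 1%R])
       (dotv (s *: p.2) (row i (J (p.1 + t *: (s *: p.2)))))%:E)%E}.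
  by apply: filter_forall => i; exact: (ac s0 (gJ i)).
apply: filterS => -[y w] /= dgE.
have mpath : measurable_fun setT (fun t : R => y + t *: (s *: w)).
  by apply: measurable_rV_D => //; exact: measurable_rV_Z.
have mJi i j : measurable_fun setT (fun t : R => J (y + t *: (s *: w)) i j).
  exact: (measurableT_comp (measurable_entry i j) (measurableT_comp mJ mpath)).
have mJi2 i : measurable_fun setT (fun t : R => \sum_j J (y + t *: (s *: w)) i j ^+ 2).
  by apply: measurable_sum => j; exact: measurable_funX.
have k0 : 0 <= s ^+ 2 * l2norm w ^+ 2 by rewrite mulr_ge0// sqr_ge0.
have coord i : (((g (y + s *: w) 0 i - g y 0 i) ^+ 2)%:E <=
    \int[leb]_(t in `[0%R, 1%R])
      (s ^+ 2 * l2norm w ^+ 2 * \sum_j J (y + t *: (s *: w)) i j ^+ 2)%:E)%E.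
  have mdot : measurable_fun setT
      (fun t : R => dotv (s *: w) (row i (J (y + t *: (s *: w))))).
    apply: measurable_dotv => //; apply: measurable_fun_mxP => k j.
    by rewrite (_ : (fun _ => _) = (fun t => J (y + t *: (s *: w)) i j))//;
      apply/funext => t; rewrite mxE.
  have := @sqr_integral_le _ _ _ leb `[0, 1]%classic (measurable_itv _) I1 _ _
    (measurable_funTS mdot) (dgE i).
  move/le_trans; apply; apply: ge0_le_integral => //.
  - by move=> t _; rewrite lee_fin sqr_ge0.
  - by apply/measurable_EFinP/measurable_funTS; exact: measurable_funX.
  - by apply/measurable_EFinP/measurable_funTS; apply: measurable_funM => //; exact: mJi2.
  - move=> t _; rewrite lee_fin (le_trans (dotv_sqr_le _ _))//.
    rewrite le_eqVlt; apply/orP; left; apply/eqP; congr (_ * _).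
      rewrite l2norm_rV_sqr mulr_sumr; apply: eq_bigr => j _.
      by rewrite mxE exprMn.
    by apply: eq_bigr => j _; rewrite mxE.
have sum_le : ((\sum_i (g (y + s *: w) - g y) 0 i ^+ 2)%:E <=
    (s ^+ 2 * l2norm w ^+ 2)%:E * energy s (y, w))%E.
  rewrite -sumEFin.
  apply: (@le_trans _ _ (\sum_i \int[leb]_(t in `[0%R, 1%R])
      (s ^+ 2 * l2norm w ^+ 2 * \sum_j J (y + t *: (s *: w)) i j ^+ 2)%:E)%E).
    by apply: lee_sum => i _; rewrite !mxE; exact: coord.
  rewrite /energy /= -ge0_integralZl//; last 2 first.
  - apply/measurable_EFinP/measurable_funTS; apply: measurable_funX.
    by apply: measurable_l2normT; exact: (measurableT_comp mJ mpath).
  - by move=> t _; rewrite lee_fin sqr_ge0.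
  rewrite -ge0_integral_sum//; last 2 first.
  - by move=> i; apply/measurable_EFinP/measurable_funTS; apply: measurable_funM => //; exact: mJi2.
  - move=> i t _; rewrite lee_fin mulr_ge0// sumr_ge0// => j _; exact: sqr_ge0.
  rewrite le_eqVlt; apply/orP; left; apply/eqP; apply: eq_integral => t _.
  by rewrite sumEFin -EFinM -mulr_sumr -l2norm_sqr.
have w0 : 0 <= l2norm w ^+ 2 by exact: sqr_ge0.
apply: (@le_trans _ _ ((l2norm w ^+ 2)%:E *
    (\sum_i (g (y + s *: w) - g y) 0 i ^+ 2)%:E)%E).
  by rewrite -EFinM lee_fin l2norm_rV_sqr dotv_sqr_le.
have -> : (s ^+ 2 * l2norm w ^+ 4)%:E =
    ((l2norm w ^+ 2)%:E * (s ^+ 2 * l2norm w ^+ 2)%:E)%E.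
  by rewrite -EFinM; congr EFin; ring.
by rewrite -muleA lee_wpmul2l// lee_fin.
Qed.

Let G4 : \bar R := (\int[m1']_z (l2norm (g z) ^+ 4)%:E)%E.
Let J2 : \bar R := (\int[m1']_z (l2norm (J z) ^+ 2)%:E)%E.
Let Y4 : \bar R := (\int[m1]_y (l2norm y ^+ 4)%:E)%E.
Let W4 : \bar R := (\int[m2']_w (l2norm w ^+ 4)%:E)%E.

Let path (s : R) (p : 'rV[R]_n * 'rV[R]_n) (t : R) : \bar R :=
  (l2norm (J (p.1 + t *: (s *: p.2))) ^+ 2 * \1_(`[0, 1]%classic : set R) t)%:E.

Let path_ge0 s p t : (0 <= path s p t)%E.
Proof. by rewrite lee_fin mulr_ge0 ?sqr_ge0. Qed.

Let mpath s : measurable_fun setT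
  (fun pt : 'rV[R]_n * 'rV[R]_n * measurableTypeR R => path s pt.1 pt.2).
Proof.
apply/measurable_EFinP; apply: measurable_funM; last first.
  apply: (measurableT_comp _ measurable_snd).
  exact: (measurable_indic (measurable_itv `[0, 1]%R)).
apply: measurable_funX; apply: measurable_l2normT; apply: (measurableT_comp mJ).
apply: measurable_rV_D; first exact: (measurableT_comp measurable_fst measurable_fst).
apply: measurable_rV_Z; first exact: measurable_snd.
apply: measurable_rV_Z => //.
exact: (measurableT_comp measurable_snd measurable_fst).
Qed.

Let energyE s p : energy s p = (\int[leb]_t path s p t)%E.
Proof.
rewrite /energy integral_mkcond; apply: eq_integral => t _.
by rewrite /path patchE indicE; case: ifP => _; rewrite ?mulr1 ?mulr0.
Qed.

Let energy_ge0 s p : (0 <= energy s p)%E.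
Proof. by apply: integral_ge0 => t _; rewrite lee_fin sqr_ge0. Qed.

Let measurable_energy s : measurable_fun setT (energy s).
Proof.
rewrite (_ : energy s = fun p => \int[leb]_t path s p t)%E; last first.
  by apply/funext => p; exact: energyE.
exact: (@measurable_integral_snd _ _ ('rV[R]_n * 'rV[R]_n)%type (measurableTypeR R) _ leb (path s)).
Qed.

Let mW4 : measurable_fun setT (fun w : 'rV[R]_n => (l2norm w ^+ 4)%:E).
Proof. by apply/measurable_EFinP; apply: measurable_funX; exact: measurable_l2norm. Qed.

Let mJ2 : measurable_fun setT (fun z => (l2norm (J z) ^+ 2)%:E).
Proof. by apply/measurable_EFinP; apply: measurable_funX; exact: measurable_l2normT. Qed.

Let mG4 : measurable_fun setT (fun z => (l2norm (g z) ^+ 4)%:E).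
Proof. by apply/measurable_EFinP; apply: measurable_funX; exact: measurable_l2normT. Qed.

Let pow4_ge0 (x : R) : (0 <= (x ^+ 4)%:E)%E.
Proof. by rewrite lee_fin exprn_even_ge0. Qed.

Let pow2_ge0 (x : R) : (0 <= (x ^+ 2)%:E)%E.
Proof. by rewrite lee_fin sqr_ge0. Qed.

(** Integrating over the segment last, the inner integral at time t is a moment of
    (Y + t s W, W), to which the domination applies with (t s)^2 <= s^2. *)
Lemma integral_energy_le (s : R) : s ^+ 2 <= a / 2 ->
  (\int[m1 \x m2]_p ((l2norm p.2 ^+ 4)%:E * energy s p) <= C%:E * (W4 * J2))%E.
Proof.
move=> sa.
have mh : measurable_fun setT
    (fun pt : 'rV[R]_n * 'rV[R]_n * measurableTypeR R =>
      (l2norm pt.1.2 ^+ 4)%:E * path s pt.1 pt.2)%E.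
  apply: emeasurable_funM => //; apply: (measurableT_comp mW4).
  exact: (measurableT_comp measurable_snd measurable_fst).
have h_ge0 p t : (0 <= (l2norm p.2 ^+ 4)%:E * path s p t)%E by exact: mule_ge0.
have -> : (\int[m1 \x m2]_p ((l2norm p.2 ^+ 4)%:E * energy s p) =
    \int[m1 \x m2]_p \int[leb]_t ((l2norm p.2 ^+ 4)%:E * path s p t))%E.
  apply: eq_integral => p _; rewrite energyE ge0_integralZl//.
  exact: (measurable_fun_pair2 p (mpath s)).
have mhE : measurable_fun setT
    (fun p : 'rV[R]_n * 'rV[R]_n => \int[leb]_t ((l2norm p.2 ^+ 4)%:E * path s p t))%E.
  exact: (@measurable_integral_snd _ _ ('rV[R]_n * 'rV[R]_n)%type
    (measurableTypeR R) R leb (fun p t => (l2norm p.2 ^+ 4)%:E * path s p t)%E).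
rewrite (@fubini_tonelli1 _ _ _ _ _ m1 m2 _ mhE (fun=> integral_ge0 _ (fun _ _ => h_ge0 _ _))).
rewrite /fubini_F.
have mwt y : measurable_fun setT (fun wt : 'rV[R]_n * measurableTypeR R =>
    (l2norm wt.1 ^+ 4)%:E * path s (y, wt.1) wt.2)%E.
  have mf : measurable_fun setT
      (fun wt : 'rV[R]_n * measurableTypeR R => (y, wt.1, wt.2)).
    by apply: measurable_fun_pair => //; exact: measurable_fun_pair.
  exact: (measurableT_comp mh mf).
have mytw : measurable_fun setT (fun ytw : 'rV[R]_n * measurableTypeR R * 'rV[R]_n =>
    (l2norm ytw.2 ^+ 4)%:E * path s (ytw.1.1, ytw.2) ytw.1.2)%E.
  have mf : measurable_fun setT (fun ytw : 'rV[R]_n * measurableTypeR R * 'rV[R]_n =>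
      (ytw.1.1, ytw.2, ytw.1.2)).
    apply: measurable_fun_pair; last exact: (measurableT_comp measurable_snd measurable_fst).
    apply: measurable_fun_pair => //.
    exact: (measurableT_comp measurable_fst measurable_fst).
  exact: (measurableT_comp mh mf).
have myt : measurable_fun setT (fun yt : 'rV[R]_n * measurableTypeR R =>
    \int[m2]_w ((l2norm w ^+ 4)%:E * path s (yt.1, w) yt.2))%E.
  exact: (@measurable_integral_snd _ _ ('rV[R]_n * measurableTypeR R)%type _ R m2
    (fun yt w => (l2norm w ^+ 4)%:E * path s (yt.1, w) yt.2)%E
    mytw (fun yt w => h_ge0 (yt.1, w) yt.2)).
under eq_integral => y _.
  rewrite (@tonelli_swap _ _ _ (measurableTypeR R) R m2 leb _ (mwt y) (fun w t => h_ge0 (y, w) t)).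
  over.
rewrite (@tonelli_swap _ _ _ (measurableTypeR R) R m1 leb
  (fun y t => \int[m2]_w ((l2norm w ^+ 4)%:E * path s (y, w) t))%E myt
  (fun y t => integral_ge0 _ (fun w _ => h_ge0 (y, w) t))).
have CWJ : (0 <= C%:E * (W4 * J2))%E.
  by rewrite !mule_ge0 ?lee_fin//; exact: integral_ge0.
apply: (@le_trans _ _
  (\int[leb]_t (C%:E * (W4 * J2) * (\1_(`[0, 1]%classic : set R) t)%:E))%E); last first.
  rewrite ge0_integralZl//; last first.
    by apply/measurable_EFinP; exact: (measurable_indic (measurable_itv `[0, 1]%R)).
  rewrite integral_indic// setIT.
  by rewrite [X in (_ * X)%E](_ : _ = 1%E) ?mule1//; exact: I1.
apply: ge0_le_integral => //.
- move=> t _; apply: integral_ge0 => y _; apply: integral_ge0 => w _.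
  exact: (h_ge0 (y, w) t).
- exact: (@measurable_integral_fst _ _ _ (measurableTypeR R) R m1
    (fun y t => \int[m2]_w ((l2norm w ^+ 4)%:E * path s (y, w) t))%E myt
    (fun y t => integral_ge0 _ (fun w _ => h_ge0 (y, w) t))).
- apply: emeasurable_funM => //.
  by apply/measurable_EFinP; exact: (measurable_indic (measurable_itv `[0, 1]%R)).
move=> t _; rewrite /path indicE.
have [|tN] := boolP (t \in `[0, 1]%classic); last first.
  rewrite mule0 integral0_eq// => y _; rewrite integral0_eq// => w _.
  by rewrite mulr0 mule0.
rewrite inE/= in_itv/= => /andP[t0 t1]; rewrite mule1.
pose F (zw : 'rV[R]_n * 'rV[R]_n) := ((l2norm zw.2 ^+ 4)%:E * (l2norm (J zw.1) ^+ 2)%:E)%E.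
have mF : measurable_fun setT F.
  apply: emeasurable_funM.
    exact: (measurableT_comp mW4 measurable_snd).
  exact: (measurableT_comp mJ2 measurable_fst).
have F0 zw : (0 <= F zw)%E by exact: mule_ge0.
rewrite [leLHS](_ : _ = \int[m1]_y \int[m2]_w F (y + (t * s) *: w, w)%R)%E; last first.
  apply: eq_integral => y _; apply: eq_integral => w _.
  by rewrite /F mulr1 scalerA.
have ts : (t * s) ^+ 2 <= a / 2.
  apply: le_trans sa; rewrite exprMn ler_piMl ?sqr_ge0//.
  by rewrite exprn_ile1.
apply: le_trans (dom ts mF F0) _; rewrite lee_wpmul2l ?lee_fin//.
rewrite le_eqVlt; apply/orP; left; apply/eqP.
rewrite /J2 -ge0_integralZl//; last exact: integral_ge0.
apply: eq_integral => z _; rewrite /F /= ge0_integralZr//.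
Qed.

Let integral_cst1 (m : {sigma_finite_measure set 'rV[R]_n -> \bar R}) (x : R) :
  m setT = 1%E -> (\int[m]_w x%:E = x%:E)%E.
Proof.
by move=> mT; rewrite integral_cst//= [X in (_ * X)%E](_ : _ = 1%E) ?mule1.
Qed.

Lemma integral_residual_le (s : R) : s ^+ 2 <= a / 2 ->
  (\int[m1 \x m2]_p (l2norm (g (p.1 + s *: p.2) - p.1) ^+ 4)%:E <=
   8%:E * (C%:E * G4) + 8%:E * Y4)%E.
Proof.
move=> sa.
have mgs : measurable_fun setT
    (fun p : 'rV[R]_n * 'rV[R]_n => (l2norm (g (p.1 + s *: p.2)) ^+ 4)%:E).
  exact: (measurableT_comp mG4 (mshift s)).
have my : measurable_fun setT (fun p : 'rV[R]_n * 'rV[R]_n => (l2norm p.1 ^+ 4)%:E).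
  exact: (measurableT_comp mW4 measurable_fst).
apply: (@le_trans _ _ (\int[m1 \x m2]_p
    (8%:E * (l2norm (g (p.1 + s *: p.2)) ^+ 4)%:E + 8%:E * (l2norm p.1 ^+ 4)%:E))%E).
  apply: ge0_le_integral => //.
  - apply/measurable_EFinP; apply: measurable_funX; apply: measurable_l2normT.
    by apply: measurable_rV_B => //; exact: (measurableT_comp mg (mshift s)).
  - by apply: emeasurable_funD; apply: emeasurable_funM.
  - by move=> p _; rewrite -!EFinM -EFinD lee_fin l2norm_pow4B_le.
rewrite ge0_integralD//; last 4 first.
- by move=> p _; rewrite mule_ge0.
- exact: emeasurable_funM.
- by move=> p _; rewrite mule_ge0.
- exact: emeasurable_funM.
rewrite !ge0_integralZl//.
apply: leeD.
  rewrite lee_wpmul2l ?lee_fin//.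
  rewrite (@fubini_tonelli1 _ _ _ _ _ m1 m2 _ mgs (fun=> pow4_ge0 _)).
  apply: le_trans (dom sa (measurableT_comp mG4 measurable_fst) (fun=> pow4_ge0 _)) _.
  rewrite lee_wpmul2l ?lee_fin// le_eqVlt; apply/orP; left; apply/eqP.
  by apply: eq_integral => z _; exact: (integral_cst1 (l2norm (g z) ^+ 4) m2T').
rewrite lee_wpmul2l ?lee_fin//.
rewrite (@fubini_tonelli1 _ _ _ _ _ m1 m2 _ my (fun=> pow4_ge0 _)).
rewrite le_eqVlt; apply/orP; left; apply/eqP.
by apply: eq_integral => y _; exact: (integral_cst1 (l2norm y ^+ 4) m2T).
Qed.

(** The summand of the cross-validation estimator at w, minus the term
    (2 / s) w . (g y - y) that is linear in w. *)
Definition cv_remainder (s : R) (p : 'rV[R]_n * 'rV[R]_n) : R :=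
  l2norm (g (p.1 + s *: p.2) - p.1) ^+ 2 +
  2 / s * dotv p.2 (g (p.1 + s *: p.2) - g p.1).

Lemma measurable_cv_remainder s : measurable_fun setT (cv_remainder s).
Proof.
have mgs : measurable_fun setT (fun p : 'rV[R]_n * 'rV[R]_n => g (p.1 + s *: p.2)).
  exact: (measurableT_comp mg (mshift s)).
apply: measurable_funD.
  by apply: measurable_funX; apply: measurable_l2normT; exact: measurable_rV_B.
apply: measurable_funM => //; apply: measurable_dotv => //.
by apply: measurable_rV_B => //; exact: (measurableT_comp mg measurable_fst).
Qed.

Lemma integral_cv_remainder_le (s : R) : 0 < s -> s ^+ 2 <= a / 2 ->
  (\int[m1 \x m2]_p (cv_remainder s p ^+ 2)%:E <=
   2%:E * (8%:E * (C%:E * G4) + 8%:E * Y4) + 8%:E * (C%:E * (W4 * J2)))%E.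
Proof.
move=> s0 sa.
have mres : measurable_fun setT (fun p : 'rV[R]_n * 'rV[R]_n =>
    (l2norm (g (p.1 + s *: p.2) - p.1) ^+ 4)%:E).
  apply/measurable_EFinP; apply: measurable_funX; apply: measurable_l2normT.
  by apply: measurable_rV_B => //; exact: (measurableT_comp mg (mshift s)).
have men : measurable_fun setT (fun p : 'rV[R]_n * 'rV[R]_n =>
    (l2norm p.2 ^+ 4)%:E * energy s p)%E.
  apply: emeasurable_funM; last exact: measurable_energy.
  exact: (measurableT_comp mW4 measurable_snd).
have en0 p : (0 <= (l2norm p.2 ^+ 4)%:E * energy s p)%E by exact: mule_ge0.
apply: (@le_trans _ _ (\int[m1 \x m2]_p
    (2%:E * (l2norm (g (p.1 + s *: p.2) - p.1) ^+ 4)%:E +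
     8%:E * ((l2norm p.2 ^+ 4)%:E * energy s p)))%E); last first.
  rewrite ge0_integralD//; last 4 first.
  - by move=> p _; rewrite mule_ge0.
  - exact: emeasurable_funM.
  - by move=> p _; rewrite mule_ge0.
  - exact: emeasurable_funM.
  rewrite !ge0_integralZl//.
  apply: leeD; rewrite lee_wpmul2l ?lee_fin//.
    exact: integral_residual_le.
  exact: integral_energy_le.
apply: ae_ge0_le_integral => //.
- by apply/measurable_EFinP; apply: measurable_funX; exact: measurable_cv_remainder.
- by move=> p _; rewrite adde_ge0// mule_ge0.
- by apply: emeasurable_funD; exact: emeasurable_funM.
have := weak_difference_le (lt0r_neq0 s0); apply: filterS => p dp _.
set A := l2norm (g (p.1 + s *: p.2) - p.1); set B := dotv p.2 (g (p.1 + s *: p.2) - g p.1).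
have k0 : 0 <= 8 / s ^+ 2 by rewrite divr_ge0// sqr_ge0.
apply: (@le_trans _ _ (2%:E * (A ^+ 4)%:E + (8 / s ^+ 2)%:E * (B ^+ 2)%:E)%E).
  rewrite -!EFinM -EFinD lee_fin /cv_remainder -/A -/B.
  have -> : 8 / s ^+ 2 * B ^+ 2 = 2 * (2 / s * B) ^+ 2 by field; rewrite gt_eqF.
  have -> : A ^+ 4 = (A ^+ 2) ^+ 2 by rewrite -exprM.
  by have := sqr_ge0 (A ^+ 2 - 2 / s * B); nra.
rewrite leeD2l//.
have -> : (8%:E * ((l2norm p.2 ^+ 4)%:E * energy s p) =
    (8 / s ^+ 2)%:E * ((s ^+ 2 * l2norm p.2 ^+ 4)%:E * energy s p))%E.
  rewrite !muleA -!EFinM; congr (_%:E * _)%E.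
  by field; rewrite gt_eqF.
by rewrite lee_wpmul2l ?lee_fin.
Qed.

Lemma cv_remainder_le_uniform :
  (G4 < +oo)%E -> (J2 < +oo)%E -> (Y4 < +oo)%E -> (W4 < +oo)%E ->
  exists2 B : R, 0 <= B & forall s : R, 0 < s -> s ^+ 2 <= a / 2 ->
    (\int[m1 \x m2]_p (cv_remainder s p ^+ 2)%:E <= B%:E)%E.
Proof.
have fin (m : {sigma_finite_measure set 'rV[R]_n -> \bar R}) (f : 'rV[R]_n -> R) :
    (forall x, 0 <= f x) -> (\int[m]_x (f x)%:E < +oo)%E ->
    exists2 r : R, 0 <= r & (\int[m]_x (f x)%:E = r%:E)%E.
  move=> f0 foo; have i0 : (0 <= \int[m]_x (f x)%:E)%E.
    by apply: integral_ge0 => x _; rewrite lee_fin.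
  exists (fine (\int[m]_x (f x)%:E)%E); first exact: fine_ge0.
  by rewrite fineK// ge0_fin_numE.
have x4 (x : R) : 0 <= x ^+ 4 by rewrite exprn_even_ge0.
move=> /(fin _ _ (fun=> x4 _))[rg rg0 gE] /(fin _ _ (fun=> sqr_ge0 _))[rJ rJ0 JE].
move=> /(fin _ _ (fun=> x4 _))[rY rY0 YE] /(fin _ _ (fun=> x4 _))[rW rW0 WE].
exists (2 * (8 * (C * rg) + 8 * rY) + 8 * (C * (rW * rJ))).
  by rewrite !(addr_ge0, mulr_ge0).
move=> s s0 sa; apply: le_trans (integral_cv_remainder_le s0 sa) _.
by rewrite /G4 /J2 /Y4 /W4 gE JE YE WE.
Qed.

(** The case s = 0 of [integral_residual_le]. *)
Lemma integral_residual4_lty : (0 <= a) -> (G4 < +oo)%E -> (Y4 < +oo)%E ->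
  (\int[m1]_y (l2norm (g y - y) ^+ 4)%:E < +oo)%E.
Proof.
move=> a0 G4oo Y4oo.
have sa : 0 ^+ 2 <= a / 2 by rewrite expr0n/= divr_ge0.
have := integral_residual_le sa.
have mf : measurable_fun setT (fun p : 'rV[R]_n * 'rV[R]_n =>
    (l2norm (g (p.1 + 0 *: p.2) - p.1) ^+ 4)%:E).
  apply/measurable_EFinP; apply: measurable_funX; apply: measurable_l2normT.
  by apply: measurable_rV_B => //; exact: (measurableT_comp mg (mshift 0)).
rewrite (@fubini_tonelli1 _ _ _ _ _ m1 m2 _ mf (fun=> pow4_ge0 _)).
rewrite (_ : integral _ _ _ = \int[m1]_y (l2norm (g y - y) ^+ 4)%:E)%E; last first.
  apply: eq_integral => y _; rewrite /fubini_F/=.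
  under eq_integral do rewrite scale0r addr0.
  exact: integral_cst1.
move/le_lt_trans; apply.
by rewrite lte_add_pinfty// lte_mul_pinfty// lte_mul_pinfty.
Qed.

End difference_quotient.

(** * Second moments of the randomization *)

Section second_moments.
Context {d : measure_display} {T : measurableType d} {R : realType}.
Variable P : probability T R.

Lemma integral_sqr_lincomb (I : finType) (X : I -> T -> R) (c : I -> I -> R) (a : I -> R) :
  (forall i j, P.-integrable setT (fun w => (X i w * X j w)%:E)) ->
  (forall i j, \int[P]_w (X i w * X j w)%:E = (c i j)%:E)%E ->
  (\int[P]_w ((\sum_i a i * X i w) ^+ 2)%:E =
   (\sum_i \sum_j a i * a j * c i j)%:E)%E.
Proof.
move=> intX cE.
transitivity (\int[P]_w (\sum_i \sum_j (a i * a j)%:E * (X i w * X j w)%:E))%E.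
  apply: eq_integral => w _; rewrite expr2 mulr_suml -sumEFin; apply: eq_bigr => i _.
  rewrite mulr_sumr -sumEFin; apply: eq_bigr => j _.
  by rewrite -EFinM; congr EFin; ring.
rewrite integral_sum//; last first.
  by move=> i; apply: integrable_sum => // j _; exact: integrableZl.
rewrite -sumEFin; apply: eq_bigr => i _.
rewrite integral_sum//; last by move=> j; exact: integrableZl.
rewrite -sumEFin; apply: eq_bigr => j _.
by rewrite integralZl// cE -EFinM.
Qed.

Lemma square_integrable_mul (X Z : T -> R) :
  measurable_fun setT X -> measurable_fun setT Z ->
  (\int[P]_w (X w ^+ 2)%:E < +oo)%E -> (\int[P]_w (Z w ^+ 2)%:E < +oo)%E ->
  P.-integrable setT (fun w => (X w * Z w)%:E).
Proof.
move=> mX mZ X2 Z2.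
have intX : P.-integrable setT (fun w => (X w ^+ 2)%:E).
  by apply: ge0_integrable => //; [exact: measurable_funX|move=> w; exact: sqr_ge0].
have intZ : P.-integrable setT (fun w => (Z w ^+ 2)%:E).
  by apply: ge0_integrable => //; [exact: measurable_funX|move=> w; exact: sqr_ge0].
apply: (le_integrable _ _ _ (integrableD _ intX intZ)) => //.
  by apply/measurable_EFinP; exact: measurable_funM.
move=> w _; rewrite /= lee_fin [leRHS]ger0_norm ?addr_ge0 ?sqr_ge0// normrM.
rewrite -[X w ^+ 2]real_normK ?num_real// -[Z w ^+ 2]real_normK ?num_real//.
have := sqr_ge0 (`|X w| - `|Z w|); have := normr_ge0 (X w); have := normr_ge0 (Z w).
by nra.
Qed.

End second_moments.

Section normal_random_vector.
Context {d : measure_display} {T : measurableType d} {R : realType}.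
Variables (P : probability T R) (n : nat) (v : R) (X : {RV P >-> 'rV[R]_n}).
Hypotheses (v0 : 0 < v) (XN : has_law P X (normal_rV 0 v)).
Local Notation RM := (measurableTypeR R).

Let mX i : measurable_fun setT (fun w => X w 0 i : RM).
Proof. exact: (measurableT_comp (measurable_entry 0 i) (measurable_funPT X)). Qed.

Definition coordinate i : {RV P >-> RM} := mfun_Sub (mem_set (mX i)).

Lemma coordinate_law i (A : set RM) : measurable A ->
  distribution P (coordinate i) A = normal_prob 0 (Num.sqrt v) A.
Proof.
move=> mA; have := normal_rV_coord (0 : 'rV[R]_n) v i mA; rewrite mxE => <-.
have mB : measurable [set w : 'rV[R]_n | A (w 0 i)].
  by rewrite -[X in measurable X]setTI; exact: measurable_entry.
exact: (XN mB).
Qed.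

Lemma coordinate_independent i j : i != j ->
  independent_rv P (coordinate i) (coordinate j).
Proof.
move=> ij A B mA mB.
have mAB (k : 'I_n) (D : set RM) : measurable D -> measurable [set w : 'rV[R]_n | D (w 0 k)].
  by move=> mD; rewrite -[X in measurable X]setTI; exact: measurable_entry.
have := normal_rV_coord2 (0 : 'rV[R]_n) v ij mA mB; rewrite !mxE.
rewrite -(coordinate_law i mA) -(coordinate_law j mB) => <-.
rewrite -(XN (measurableI _ _ (mAB i _ mA) (mAB j _ mB)))//.
Qed.

Let sv0 : 0 < Num.sqrt v. Proof. by rewrite sqrtr_gt0. Qed.

Lemma integral_coordinate_sqr i : (\int[P]_w (X w 0%R i ^+ 2)%:E = v%:E)%E.
Proof.
have mf : measurable_fun setT (fun x : RM => (x ^+ 2)%:E).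
  by apply/measurable_EFinP; exact: measurable_funX.
rewrite -(ge0_integral_distribution (coordinate i) mf); last first.
  by move=> x; rewrite lee_fin sqr_ge0.
rewrite -[v in RHS](sqr_sqrtr (ltW v0)) -integral_normal_sqr//.
by apply: eq_measure_integral => A mA _; exact: coordinate_law.
Qed.

Lemma integrable_coordinate_mul i j :
  P.-integrable setT (fun w => (X w 0 i * X w 0 j)%:E).
Proof.
by apply: square_integrable_mul; rewrite ?integral_coordinate_sqr ?ltry//; exact: mX.
Qed.

Lemma integrable_coordinate i : P.-integrable setT (fun w => (X w 0 i)%:E).
Proof.
by apply: square_integrable; rewrite ?integral_coordinate_sqr ?ltry//; exact: mX.
Qed.

Lemma integral_coordinate i : (\int[P]_w (X w 0%R i)%:E = 0)%E.
Proof.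
have mf : measurable_fun setT (fun x : RM => x%:E) by exact/measurable_EFinP.
rewrite -(integral_distribution (X := coordinate i) mf); last exact: integrable_coordinate.
rewrite -(integral_normal_id sv0).
by apply: eq_measure_integral => A mA _; exact: coordinate_law.
Qed.

Lemma integral_coordinate_mul i j :
  (\int[P]_w (X w 0%R i * X w 0%R j)%:E = (v *+ (i == j))%:E)%E.
Proof.
have [->|ij] := eqVneq i j; first by rewrite mulr1n -(integral_coordinate_sqr j).
have mF : measurable_fun setT (fun xz : RM * RM => (xz.1 * xz.2)%R).
  exact: measurable_funM.
have intF := integrable_product_distribution (coordinate_independent ij) mF
  (integrable_coordinate_mul i j).
rewrite [LHS](integral_indep (coordinate_independent ij) intF).
apply: integral0_eq => x _.
have intj := integrable_coordinate j.
have mf : measurable_fun setT (fun z : RM => (x * z)%:E).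
  by apply/measurable_EFinP; exact: measurable_funM.
have intxj : P.-integrable setT (fun w => x%:E * (X w 0%R j)%:E)%E by exact: integrableZl.
rewrite [LHS](integral_distribution (X := coordinate j) mf); last exact: intxj.
transitivity (\int[P]_w (x%:E * (X w 0%R j)%:E))%E; first exact: eq_integral.
by rewrite integralZl// integral_coordinate mule0.
Qed.

End normal_random_vector.

Section randomization.
Context {d : measure_display} {T : measurableType d} {R : realType}.
Variables (P : probability T R) (n K : nat) (v rho : R).
Variable omega : 'I_K -> {RV P >-> 'rV[R]_n}.
Hypotheses (v0 : 0 < v) (omegaN : forall k, has_law P (omega k) (normal_rV 0 v)).
Hypothesis omega_cov : forall k k', k != k' -> forall i j : 'I_n,
  covariance P (fun w => omega k w 0 i) (fun w => omega k' w 0 j) =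
  ((rho * v) *+ (i == j))%:E.

Let momega k i : measurable_fun setT (fun w => omega k w 0 i).
Proof. exact: (measurableT_comp (measurable_entry 0 i) (measurable_funPT (omega k))). Qed.

Lemma integrable_omega_mul k k' i j :
  P.-integrable setT (fun w => (omega k w 0 i * omega k' w 0 j)%:E).
Proof.
by apply: square_integrable_mul => //;
  rewrite (integral_coordinate_sqr v0 (omegaN _)) ltry.
Qed.

Lemma integral_omega_mul k k' i j :
  (\int[P]_w (omega k w 0%R i * omega k' w 0%R j)%:E =
   ((if k == k' then v else rho * v) *+ (i == j))%:E)%E.
Proof.
have [->|kk'] := eqVneq k k'; first exact: (integral_coordinate_mul v0 (omegaN _)).
rewrite -(omega_cov kk' i j) [in RHS]unlock.
have E0 k0 i0 : ('E_P[fun w => omega k0 w 0%R i0] = 0)%E.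
  by rewrite unlock; exact: (integral_coordinate v0 (omegaN k0)).
rewrite !E0 /= unlock; apply: eq_integral => w _.
congr EFin.
transitivity ((omega k w 0 i - 0) * (omega k' w 0 j - 0)); last by [].
by rewrite !subr0.
Qed.

(** The variance of each coordinate of the sum of the K vectors; for
    K >= 2 and v > 0 it vanishes exactly when rho = - 1 / (K - 1). *)
Definition total_variance : R := K%:R * v * (1 + (K.-1)%:R * rho).

Lemma total_dotvE (q : 'rV[R]_n) w : dotv (\sum_k omega k w) q =
  \sum_(p : 'I_K * 'I_n) q 0 p.2 * omega p.1 w 0 p.2.
Proof.
rewrite -(pair_big xpredT xpredT (fun k j => q 0 j * omega k w 0 j))/=.
rewrite exchange_big/= /dotv; apply: eq_bigr => j _.
by rewrite summxE mulrC mulr_sumr.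
Qed.

Lemma integral_total_dotv (q : 'rV[R]_n) :
  (\int[P]_w (dotv (\sum_k omega k w) q)%:E = 0)%E.
Proof.
have intw (p : 'I_K * 'I_n) : P.-integrable setT (fun w => (omega p.1 w 0 p.2)%:E).
  exact: (integrable_coordinate v0 (omegaN p.1)).
transitivity (\int[P]_w
    (\sum_(p : 'I_K * 'I_n) (q 0%R p.2)%:E * (omega p.1 w 0%R p.2)%:E))%E.
  apply: eq_integral => w _; rewrite total_dotvE -sumEFin.
  by apply: eq_bigr => p _; rewrite EFinM.
rewrite integral_sum//; last by move=> p; exact: integrableZl.
apply: big1 => p _; rewrite integralZl//.
by rewrite (integral_coordinate v0 (omegaN p.1)) mule0.
Qed.

Lemma integral_total_dotv_sqr (q : 'rV[R]_n) :
  (\int[P]_w (dotv (\sum_k omega k w) q ^+ 2)%:E =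
   (total_variance * l2norm q ^+ 2)%:E)%E.
Proof.
under eq_integral do rewrite total_dotvE.
rewrite (integral_sqr_lincomb (I := ('I_K * 'I_n)%type)
  (X := fun p w => omega p.1 w 0 p.2)
  (c := fun p p' => (if p.1 == p'.1 then v else rho * v) *+ (p.2 == p'.2))
  (fun p => q 0 p.2)); last 2 first.
- by move=> p p'; exact: integrable_omega_mul.
- by move=> p p'; exact: integral_omega_mul.
congr EFin.
have sum_c (k : 'I_K) : \sum_k' (if k == k' then v else rho * v) = v + (K.-1)%:R * rho * v.
  rewrite (bigD1 k)//= eqxx; congr (_ + _).
  rewrite (eq_bigr (fun=> rho * v)); last by move=> k' /negbTE; rewrite eq_sym => ->.
  by rewrite sumr_const cardC1 card_ord -[LHS]mulr_natl mulrA.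
rewrite -(pair_big xpredT xpredT (fun k j => \sum_(p' : 'I_K * 'I_n)
  q 0 j * q 0 p'.2 * ((if k == p'.1 then v else rho * v) *+ (j == p'.2))))/=.
rewrite /total_variance l2norm_rV_sqr.
transitivity (\sum_(k < K) (v + (K.-1)%:R * rho * v) * \sum_j q 0 j ^+ 2); last first.
  by rewrite sumr_const card_ord -[LHS]mulr_natl; ring.
apply: eq_bigr => k _; rewrite mulr_sumr; apply: eq_bigr => j _.
rewrite -(pair_big xpredT xpredT (fun k' j' =>
  q 0 j * q 0 j' * ((if k == k' then v else rho * v) *+ (j == j'))))/=.
rewrite -(sum_c k) mulr_suml; apply: eq_bigr => k' _.
rewrite (bigD1 j)//= eqxx mulr1n big1 ?addr0; last first.
  by move=> j' /negbTE; rewrite eq_sym => ->; rewrite mulr0n mulr0.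
by rewrite expr2 mulrC.
Qed.

End randomization.

Lemma normal_rV_ac {R : realType} n (mu : 'rV[R]_n) (v b : R)
    (Q : 'rV[R]_n * 'rV[R]_n -> Prop) : 0 < v -> b != 0 ->
  {ae (lebesgue_rV n \x lebesgue_rV n)%E, forall yz, Q yz} ->
  {ae (normal_rV mu v \x normal_rV 0 v)%E, forall yw, Q (yw.1, b *: yw.2)}.
Proof.
move=> v0 b0 [N [mN N0 QN]].
pose f (yw : 'rV[R]_n * 'rV[R]_n) := (yw.1, b *: yw.2).
have mf : measurable_fun setT f.
  by apply: measurable_fun_pair => //; exact: measurable_rV_Z.
exists (f @^-1` N); split.
- by rewrite -[X in measurable X]setTI; exact: mf.
- set m1 := normal_rV mu v; set m2 := normal_rV 0 v.
  have m1N : measurable_fun setT (fun x => (\1_N x : R)%:E).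
    by apply/measurable_EFinP; exact: measurable_indic.
  have N_ge0 (x : 'rV[R]_n * 'rV[R]_n) : (0 <= (\1_N x : R)%:E)%E by rewrite lee_fin.
  have m1fN : measurable_fun setT (fun x => (\1_N (f x) : R)%:E).
    exact: (measurableT_comp m1N mf).
  apply/eqP; rewrite eq_le measure_ge0 andbT.
  have := normal_rV_scale_le mu v0 b0 m1N N_ge0.
  rewrite -(@fubini_tonelli1 _ _ _ _ _ m1 m2 _ m1fN (fun=> N_ge0 _)).
  rewrite -(@fubini_tonelli1 _ _ _ _ _ (lebesgue_rV n) (lebesgue_rV n) _ m1N N_ge0).
  have -> : (\int[lebesgue_rV n \x lebesgue_rV n]_x (\1_N x)%:E = 0)%E.
    by rewrite integral_indic// setIT.
  rewrite mule0; apply: le_trans.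
  rewrite [leRHS](_ : _ = \int[m1 \x m2]_x (\1_(f @^-1` N) x)%:E)%E; last first.
    by apply: eq_integral.
  rewrite integral_indic ?setIT//.
  by rewrite -[X in measurable X]setTI; exact: mf.
- by move=> x Qx; exact: QN.
Qed.

(** * Decomposition of the cross-validation estimator *)

Section cv_split.
Context {R : realType}.
Variables (n K : nat) (g : 'rV[R]_n -> 'rV[R]_n).
Implicit Types (s : R) (yV : 'rV[R]_n * 'M[R]_(K, n)).

(** The estimator as a function of s = sqrt alpha, of the observation and of the matrix
    of randomization vectors. *)
Definition cv_value s yV : R := K%:R^-1 * \sum_(k < K)
  (l2norm (g (yV.1 + s *: row k yV.2) - (yV.1 - s^-1 *: row k yV.2)) ^+ 2
   - (s ^+ 2)^-1 * l2norm (row k yV.2) ^+ 2).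

Definition cv_leading s yV : R :=
  2 / (K%:R * s) * dotv (\sum_k row k yV.2) (g yV.1 - yV.1).

Definition cv_rest s yV : R :=
  K%:R^-1 * \sum_k cv_remainder g s (yV.1, row k yV.2).

Lemma dotv_suml (I : finType) (u : I -> 'rV[R]_n) q :
  dotv (\sum_i u i) q = \sum_i dotv (u i) q.
Proof.
rewrite /dotv exchange_big/=; apply: eq_bigr => j _.
by rewrite summxE mulr_suml.
Qed.

(** Expanding the square at g (y + s w) - y, the term |w|^2 / s^2 cancels. *)
Lemma cv_term_split s (y w : 'rV[R]_n) : s != 0 ->
  l2norm (g (y + s *: w) - (y - s^-1 *: w)) ^+ 2 - (s ^+ 2)^-1 * l2norm w ^+ 2 =
  2 / s * dotv w (g y - y) + cv_remainder g s (y, w).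
Proof.
move=> s0; rewrite /cv_remainder !l2norm_rV_sqr /dotv !mulr_sumr -sumrB -!big_split/=.
by apply: eq_bigr => j _; rewrite !mxE; field.
Qed.

Lemma cv_value_split s yV : s != 0 -> cv_value s yV = cv_leading s yV + cv_rest s yV.
Proof.
move=> s0; rewrite /cv_value /cv_leading /cv_rest.
under eq_bigr do rewrite cv_term_split//.
rewrite big_split/= mulrDr; congr (_ + _).
rewrite -mulr_sumr -dotv_suml mulrA; congr (_ * _).
by rewrite invfM mulrCA.
Qed.

Lemma measurable_row (k : 'I_K) : measurable_fun setT (fun V : 'M[R]_(K, n) => row k V).
Proof.
apply: measurable_fun_mxP => i j.
rewrite (_ : (fun _ => _) = (fun V : 'M[R]_(K, n) => V k j)); last first.
  by apply/funext => V; rewrite mxE.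
exact: measurable_entry.
Qed.

Hypothesis mg : measurable_fun setT g.

Lemma measurable_cv_rest s : measurable_fun setT (cv_rest s).
Proof.
apply: measurable_funM => //; apply: measurable_sum => k.
apply: (measurableT_comp (measurable_cv_remainder mg s)).
apply: measurable_fun_pair => //.
exact: (measurableT_comp (measurable_row k) measurable_snd).
Qed.

Lemma measurable_row_sum :
  measurable_fun setT (fun V : 'M[R]_(K, n) => \sum_k row k V).
Proof.
apply: measurable_fun_mxP => i j.
rewrite (_ : (fun _ => _) = (fun V : 'M[R]_(K, n) => \sum_k V k j)); last first.
  by apply/funext => V; rewrite summxE; apply: eq_bigr => k _; rewrite mxE.
by apply: measurable_sum => k; exact: measurable_entry.
Qed.

Lemma measurable_cv_leading s : measurable_fun setT (cv_leading s).
Proof.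
apply: measurable_funM => //; apply: measurable_dotv.
  exact: (measurableT_comp measurable_row_sum measurable_snd).
by apply: measurable_rV_B => //; exact: (measurableT_comp mg measurable_fst).
Qed.

End cv_split.

(** * Bounds on the mean conditional variance *)

Section cross_validation.
Context {d : measure_display} {T : measurableType d} {R : realType}.
Variables (P : probability T R) (n K : nat) (mu : 'rV[R]_n) (v rho a : R).
Variables (Y : {RV P >-> 'rV[R]_n}) (omega : 'I_K -> {RV P >-> 'rV[R]_n}).
Variables (g : 'rV[R]_n -> 'rV[R]_n) (J : 'rV[R]_n -> 'M[R]_n).
Hypotheses (K0 : (0 < K)%N) (v0 : 0 < v) (a0 : 0 < a).
Hypothesis YN : has_law P Y (normal_rV mu v).
Hypothesis indep : independent_rv P Y (joint omega).
Hypothesis omegaN : forall k, has_law P (omega k) (normal_rV 0 v).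
Hypothesis omega_cov : forall k k', k != k' -> forall i j : 'I_n,
  covariance P (fun w => omega k w 0 i) (fun w => omega k' w 0 j) =
  ((rho * v) *+ (i == j))%:E.
Hypotheses (mg : measurable_fun setT g) (mJ : measurable_fun setT J).
Hypothesis gJ : forall i, is_weak_gradient (fun y => g y 0 i) (fun y => row i (J y)).
Hypothesis g4 :
  (\int[normal_rV mu ((1 + a) * v)]_z (l2norm (g z) ^+ 4)%:E < +oo)%E.
Hypothesis J2 :
  (\int[normal_rV mu ((1 + a) * v)]_z (l2norm (J z) ^+ 2)%:E < +oo)%E.

Let mjoint : measurable_fun setT (joint omega).
Proof.
apply: measurable_fun_mxP => k j; under eq_fun do rewrite mxE.
exact: (measurableT_comp (measurable_entry 0 j) (measurable_funPT (omega k))).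
Qed.

Let W : {RV P >-> 'M[R]_(K, n)} := mfun_Sub (mem_set mjoint).

Let indepW : independent_rv P Y W. Proof. exact: indep. Qed.

Let rowW k w : row k (W w) = omega k w.
Proof. exact: rowK. Qed.

Let indep_omega k : independent_rv P Y (omega k).
Proof.
move=> A B mA mB.
have mB' : measurable [set V : 'M[R]_(K, n) | B (row k V)].
  by rewrite -[X in measurable X]setTI; exact: (measurable_row k).
have := indep mA mB'.
rewrite (_ : joint omega @^-1` _ = omega k @^-1` B)//.
by apply/seteqP; split => w /=; rewrite (rowW k w).
Qed.

Let integral_Y_omega k (f : 'rV[R]_n * 'rV[R]_n -> \bar R) :
  measurable_fun setT f -> (forall x, 0 <= f x)%E ->
  (\int[P]_w f (Y w, omega k w) =
   \int[(normal_rV mu v \x normal_rV 0 v)%E]_p f p)%E.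
Proof.
move=> mf f0; rewrite (ge0_integral_indep (indep_omega k) mf f0).
rewrite (@fubini_tonelli1 _ _ _ _ _ (normal_rV mu v) (normal_rV 0 v) _ mf f0).
transitivity (\int[distribution P Y]_y \int[normal_rV 0 v]_w f (y, w))%E.
  apply: eq_integral => y _.
  by apply: eq_measure_integral => A mA _; exact: (omegaN k mA).
by apply: eq_measure_integral => A mA _; exact: (YN mA).
Qed.

Let dom (c : R) (F : 'rV[R]_n * 'rV[R]_n -> \bar R) :
  c ^+ 2 <= a / 2 -> measurable_fun setT F -> (forall x, 0 <= F x)%E ->
  (\int[normal_rV mu v]_y \int[normal_rV 0 v]_w F (y + c *: w, w)%R <=
   (shear_const a ^+ n)%:E *
   \int[normal_rV mu ((1 + a) * v)]_z \int[normal_rV 0 (2 * v)]_w F (z, w))%E.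
Proof. by move=> ca mF F0; exact: normal_rV_shear_le. Qed.

Let C0 : 0 <= shear_const a ^+ n.
Proof. by rewrite exprn_ge0// mulr_ge0// sqrtr_ge0. Qed.

Let v20 : 0 < 2 * v. Proof. by rewrite mulr_gt0. Qed.

Let ge2 (x : R) : (0 <= (x ^+ 2)%:E)%E. Proof. by rewrite lee_fin sqr_ge0. Qed.
Let ge4 (x : R) : (0 <= (x ^+ 4)%:E)%E. Proof. by rewrite lee_fin exprn_even_ge0. Qed.

Lemma cv_remainder_bounded : exists2 B : R, 0 <= B & forall s : R, 0 < s ->
  s ^+ 2 <= a / 2 -> forall k,
  (\int[P]_w (cv_remainder g s (Y w, omega k w) ^+ 2)%:E <= B%:E)%E.
Proof.
have [B B0 leB] := @cv_remainder_le_uniform R n (normal_rV mu v) (normal_rV 0 v)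
  (normal_rV mu ((1 + a) * v)) (normal_rV 0 (2 * v)) a _ C0 dom
  (fun b Q b0 => @normal_rV_ac R n mu v b Q v0 b0)
  (normal_rV_setT _ _) (normal_rV_setT _ _) g J mg mJ gJ g4 J2
  (normal_rV_l2norm4_lty mu v0) (normal_rV_l2norm4_lty 0 v20).
exists B => // s s0 sa k.
rewrite (integral_Y_omega k (f := fun p => (cv_remainder g s p ^+ 2)%:E))//.
  exact: leB.
by apply/measurable_EFinP; apply: measurable_funX; exact: measurable_cv_remainder.
Qed.

Definition mean_sqr_residual : \bar R := (\int[P]_w (l2norm (g (Y w) - Y w) ^+ 2)%:E)%E.

Let mgY : measurable_fun setT (fun y => (l2norm (g y - y) ^+ 2)).
Proof. by apply: measurable_funX; apply: measurable_l2normT; exact: measurable_rV_B. Qed.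

Lemma mean_sqr_residual_lty : (mean_sqr_residual < +oo)%E.
Proof.
have m4 : measurable_fun setT (fun y => (l2norm (g y - y) ^+ 4)%:E).
  apply/measurable_EFinP; apply: measurable_funX; apply: measurable_l2normT.
  exact: measurable_rV_B.
have := @integral_residual4_lty R n (normal_rV mu v) (normal_rV 0 v)
  (normal_rV mu ((1 + a) * v)) (normal_rV 0 (2 * v)) a _ C0 dom
  (normal_rV_setT _ _) (normal_rV_setT _ _) g mg (ltW a0) g4
  (normal_rV_l2norm4_lty mu v0).
rewrite -(ge0_integral_has_law YN m4)// => fin4.
have mY4 : measurable_fun setT (fun w => (l2norm (g (Y w) - Y w) ^+ 4)%:E).
  exact: (measurableT_comp m4).
apply: (@le_lt_trans _ _ (\int[P]_w (1%:E + (l2norm (g (Y w) - Y w) ^+ 4)%:E))%E).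
  apply: ge0_le_integral => //.
  - by apply/measurable_EFinP; exact: (measurableT_comp mgY).
  - exact: emeasurable_funD.
  - move=> w _; rewrite -EFinD lee_fin; set x := l2norm _.
    by have := sqr_ge0 (x ^+ 2 - 1); have := sqr_ge0 x; nra.
by rewrite ge0_integralD// integral_prob_cst lte_add_pinfty// ltry.
Qed.

Let PW_int (f : 'M[R]_(K, n) -> \bar R) : measurable_fun setT f ->
  (forall x, 0 <= f x)%E ->
  (\int[distribution P W]_V f V = \int[P]_w f (W w))%E.
Proof. by move=> mf f0; rewrite (ge0_integral_distribution W mf f0). Qed.

(** The second moment of [cv_leading], multiplied by s^2. *)
Definition leading_const : R :=
  4 / K%:R ^+ 2 * total_variance K v rho * fine mean_sqr_residual.

Let mlead s : measurable_fun setT (cv_leading (K := K) g s).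
Proof. exact: measurable_cv_leading. Qed.

Let integral_row_sum (s : R) y : (\int[distribution P W]_V (cv_leading g s (y, V) ^+ 2)%:E =
  ((2 / (K%:R * s)) ^+ 2 * (total_variance K v rho * l2norm (g y - y) ^+ 2))%:E)%E.
Proof.
have mdot : measurable_fun setT
    (fun V : 'M[R]_(K, n) => (dotv (\sum_k row k V) (g y - y) ^+ 2)%:E).
  apply/measurable_EFinP; apply: measurable_funX; apply: measurable_dotv => //.
  exact: measurable_row_sum.
transitivity (\int[distribution P W]_V (((2 / (K%:R * s)) ^+ 2)%:E *
    (dotv (\sum_k row k V) (g y - y) ^+ 2)%:E))%E.
  by apply: eq_integral => V _; rewrite /cv_leading /= exprMn EFinM.
rewrite ge0_integralZl//.
rewrite PW_int// [RHS]EFinM -(integral_total_dotv_sqr v0 omegaN omega_cov (g y - y)).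
congr (_ * _)%E; apply: eq_integral => w _.
by under eq_bigr do rewrite rowW.
Qed.

Let integral_lead0 (s : R) y :
  (\int[distribution P W]_V (cv_leading g s (y, V))%:E = 0)%E.
Proof.
have mf : measurable_fun setT (fun V => (cv_leading (K := K) g s (y, V))%:E).
  by apply/measurable_EFinP; exact: (measurable_fun_pair2 y (mlead s)).
have int1 : P.-integrable setT (fun w => (dotv (\sum_k omega k w) (g y - y))%:E).
  apply: square_integrable.
    apply: measurable_dotv => //.
    rewrite (_ : (fun _ => _) = (fun w => \sum_k row k (W w))).
      exact: (measurableT_comp (@measurable_row_sum R n K) (measurable_funPT W)).
    by apply/funext => w; apply: eq_bigr => k _; rewrite rowW.
  by rewrite (integral_total_dotv_sqr v0 omegaN omega_cov) ltry.
have E w : (cv_leading (K := K) g s (y, W w))%:E =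
    ((2 / (K%:R * s))%:E * (dotv (\sum_k omega k w) (g y - y))%:E)%E.
  by rewrite /cv_leading /= EFinM; under eq_bigr do rewrite rowW.
rewrite (integral_distribution (X := W) mf); last first.
  rewrite (_ : _ \o _ = fun w =>
    (2 / (K%:R * s))%:E * (dotv (\sum_k omega k w) (g y - y))%:E)%E; last first.
    by apply/funext => w /=; exact: E.
  exact: integrableZl.
transitivity (\int[P]_w
    ((2 / (K%:R * s))%:E * (dotv (\sum_k omega k w) (g y - y))%:E))%E.
  by apply: eq_integral => w _; exact: E.
by rewrite integralZl// (integral_total_dotv v0 omegaN) mule0.
Qed.

Lemma integral_cv_leading_sqr (s : R) : s != 0 ->
  (\int[P]_w (cv_leading g s (Y w, W w) ^+ 2)%:E = (leading_const / s ^+ 2)%:E)%E.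
Proof.
move=> s0.
have m2 : measurable_fun setT (fun yV => (cv_leading (K := K) g s yV ^+ 2)%:E).
  by apply/measurable_EFinP; exact: measurable_funX.
rewrite (ge0_integral_indep indepW m2 (fun=> ge2 _)).
transitivity (\int[distribution P Y]_y
   (((2 / (K%:R * s)) ^+ 2 * total_variance K v rho)%:E * (l2norm (g y - y) ^+ 2)%:E))%E.
  by apply: eq_integral => y _; rewrite integral_row_sum -EFinM mulrA.
have mr : measurable_fun setT (fun y => (l2norm (g y - y) ^+ 2)%:E).
  exact/measurable_EFinP.
have intr : P.-integrable setT (fun w => (l2norm (g (Y w) - Y w) ^+ 2)%:E).
  apply: ge0_integrable.
  - exact: (measurableT_comp mgY).
  - by move=> w; exact: sqr_ge0.
  - exact: mean_sqr_residual_lty.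
have intrY : (distribution P Y).-integrable setT (fun y => (l2norm (g y - y) ^+ 2)%:E).
  apply/integrableP; split => //.
  under eq_integral do rewrite gee0_abs ?ge2//.
  by rewrite (ge0_integral_distribution Y mr)//; exact: mean_sqr_residual_lty.
rewrite integralZl// (ge0_integral_distribution Y mr)//.
rewrite -[(\int[P]_x _)%E]/mean_sqr_residual.
rewrite -[mean_sqr_residual]fineK; last first.
  by rewrite ge0_fin_numE ?mean_sqr_residual_lty//; exact: integral_ge0.
rewrite -EFinM; congr EFin; rewrite /leading_const.
by field; rewrite s0 pnatr_eq0 -lt0n K0.
Qed.

Lemma integral_cv_rest_sqr B (s : R) :
  (forall k, \int[P]_w (cv_remainder g s (Y w, omega k w) ^+ 2)%:E <= B%:E)%E ->
  (\int[P]_w (cv_rest g s (Y w, W w) ^+ 2)%:E <= B%:E)%E.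
Proof.
move=> leB.
have KR : (0 : R) < K%:R by rewrite ltr0n.
have mr k : measurable_fun setT (fun w => (cv_remainder g s (Y w, omega k w) ^+ 2)%:E).
  apply/measurable_EFinP; apply: measurable_funX.
  apply: (measurableT_comp (measurable_cv_remainder mg s)).
  exact: measurable_fun_pair.
apply: (@le_trans _ _ (\int[P]_w (K%:R^-1%:E *
    \sum_k (cv_remainder g s (Y w, omega k w) ^+ 2)%:E))%E).
  apply: ge0_le_integral => //.
  - apply/measurable_EFinP; apply: measurable_funX.
    apply: (measurableT_comp (measurable_cv_rest mg s)).
    exact: measurable_fun_pair.
  - by apply: emeasurable_funM => //; exact: emeasurable_sum.
  - move=> w _; rewrite sumEFin -EFinM lee_fin /cv_rest /=.
    under eq_bigr do rewrite rowW.
    rewrite exprMn expr2 -mulrA ler_pM2l ?invr_gt0//.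
    by rewrite ler_pdivrMl// sqr_sum_le.
rewrite ge0_integralZl//; last 2 first.
- exact: emeasurable_sum.
- by move=> w _; rewrite sume_ge0.
rewrite ge0_integral_sum//.
apply: (@le_trans _ _ (K%:R^-1%:E * \sum_(k < K) B%:E)%E).
  by rewrite lee_wpmul2l ?lee_fin ?invr_ge0//; exact: lee_sum.
rewrite sumEFin sumr_const card_ord -EFinM lee_fin -[B *+ _]mulr_natl mulKf//.
by rewrite gt_eqF.
Qed.

(** With value = leading + rest, the upper bound is the second moment of the value, the
    lower bound comes from the leading part having conditional mean zero; the rest
    is bounded in mean square by B. *)
Lemma cv_bounds : exists2 B : R, 0 <= B & forall s : R, 0 < s -> s ^+ 2 <= a / 2 ->
  let X := fun w => cv_value g s (Y w, joint omega w) in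
  [/\ cond_var_defined P Y X,
      ('E_P[cond_var P Y X] <= (2 * (leading_const / s ^+ 2) + 2 * B)%:E)%E &
      ((leading_const / s ^+ 2)%:E <= 2%:E * 'E_P[cond_var P Y X] + (2 * B)%:E)%E].
Proof.
have [B B0 leB] := cv_remainder_bounded.
exists B => // s s0 sa X.
have sn0 : s != 0 by rewrite gt_eqF.
have split_cv (yV : 'rV[R]_n * 'M[R]_(K, n)) := cv_value_split g yV sn0.
have mrest : measurable_fun setT (cv_rest (K := K) g s) by exact: measurable_cv_rest.
have mF : measurable_fun setT (cv_value (K := K) g s).
  rewrite (_ : cv_value g s = fun yV => cv_leading g s yV + cv_rest g s yV).
    exact: measurable_funD.
  exact/funext.
have restB := integral_cv_rest_sqr (leB s s0 sa).
have leadE := integral_cv_leading_sqr sn0.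
have mYW (f : 'rV[R]_n * 'M[R]_(K, n) -> R) : measurable_fun setT f ->
    measurable_fun setT (fun w => (f (Y w, W w) ^+ 2)%:E).
  move=> mf; apply/measurable_EFinP; apply: measurable_funX.
  by apply: (measurableT_comp mf); exact: measurable_fun_pair.
have X2 : (\int[P]_w (X w ^+ 2)%:E <= (2 * (leading_const / s ^+ 2) + 2 * B)%:E)%E.
  apply: (@le_trans _ _ (\int[P]_w (2%:E * (cv_leading g s (Y w, W w) ^+ 2)%:E +
      2%:E * (cv_rest g s (Y w, W w) ^+ 2)%:E))%E).
    apply: ge0_le_integral => //.
    - exact: mYW.
    - by apply: emeasurable_funD; apply: emeasurable_funM => //; exact: mYW.
    - move=> w _; rewrite -!EFinM -EFinD lee_fin /X split_cv.
      by have := sqr_ge0 (cv_leading g s (Y w, W w) - cv_rest g s (Y w, W w)); nra.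
  rewrite ge0_integralD//; last 4 first.
  - by move=> w _; rewrite mule_ge0.
  - by apply: emeasurable_funM => //; exact: mYW.
  - by move=> w _; rewrite mule_ge0.
  - by apply: emeasurable_funM => //; exact: mYW.
  rewrite !ge0_integralZl//; [|exact: mYW|exact: mYW].
  rewrite leadE; apply: (@le_trans _ _
    (2%:E * (leading_const / s ^+ 2)%:E + 2%:E * B%:E)%E).
    by rewrite leeD2l// lee_wpmul2l ?lee_fin.
  by rewrite -!EFinM -EFinD.
have X2oo : (\int[P]_w (X w ^+ 2)%:E < +oo)%E by rewrite (le_lt_trans X2) ?ltry.
split.
- exact: (cond_var_indepE indepW mF X2oo).1.
- exact: le_trans (cond_var_le indepW mF X2oo) X2.
- rewrite -leadE.
  have lead2 y : (\int[distribution P W]_V (cv_leading g s (y, V) ^+ 2)%:E < +oo)%E.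
    by rewrite integral_row_sum ltry.
  have := cond_var_ge indepW mF X2oo (mlead s) mrest split_cv lead2 (integral_lead0 s).
  move/le_trans; apply.
  by rewrite leeD2l// [leRHS]EFinM lee_wpmul2l ?lee_fin.
Qed.

End cross_validation.

(** * Rates as alpha tends to 0 *)

Theorem theorem3p1 (R : realType) (n K : nat) (mu : 'rV[R]_n) (sigma2 rho : R)
    (d : measure_display) (T : measurableType d) (P : probability T R)
    (Y : {RV P >-> 'rV[R]_n}) (omega : 'I_K -> {RV P >-> 'rV[R]_n})
    (g : 'rV[R]_n -> 'rV[R]_n) :
  (1 <= n)%N -> (2 <= K)%N -> 0 < sigma2 ->
  - (K.-1)%:R^-1 <= rho <= 1 ->
  has_law P Y (normal_rV mu sigma2) ->
  independent_rv P Y (joint omega) ->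
  exchangeable_normal P sigma2 rho omega ->
  smooth_moment mu sigma2 g ->
  (0 < 'E_P[fun w => (l2norm (g (Y w) - Y w) ^+ 2)%R])%E ->
  let V := fun alpha : R => cond_var P Y (CV g Y omega alpha) in
  [/\ \forall alpha \near (0 : R)^'+, cond_var_defined P Y (CV g Y omega alpha),
      rho = - (K.-1)%:R^-1 ->
        (fun alpha => fine 'E_P[V alpha]) =O_ ((0 : R)^'+) (fun _ => 1 : R) &
      - (K.-1)%:R^-1 < rho ->
        (fun alpha => fine 'E_P[V alpha]) =Theta_ ((0 : R)^'+)
          (fun alpha => alpha^-1)].
Proof.
move=> n1 K2 v0 /andP[rho_ge rho_le] YN indep [_ omegaN omega_cov].
move=> [mg [J [mJ gJ [a a0 [g4 J2]]]]] resid0 V.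
have K0 : (0 < K)%N by exact: leq_trans K2.
have K1 : (0 : R) < (K.-1)%:R by rewrite ltr0n -subn1 subn_gt0.
have [B B0 bounds] := @cv_bounds _ _ _ _ _ _ _ _ rho _ _ _ _ _ K0 v0 a0 YN indep
  omegaN omega_cov mg mJ gJ g4 J2.
have resid_lty := @mean_sqr_residual_lty _ _ _ _ _ _ _ _ _ _ v0 a0 YN mg g4.
pose L := leading_const K sigma2 rho Y g.
have CVE alpha : 0 < alpha -> CV g Y omega alpha =
    fun w => cv_value g (Num.sqrt alpha) (Y w, joint omega w).
  move=> al0; apply/funext => w; rewrite /CV /cv_value /=; congr (_ * _).
  by apply: eq_bigr => k _; rewrite rowK (sqr_sqrtr (ltW al0)).
have bnd alpha : 0 < alpha -> alpha <= a / 2 ->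
    cond_var_defined P Y (CV g Y omega alpha) /\
    exists r : R, [/\ ('E_P[V alpha] = r%:E)%E, r <= 2 * (L / alpha) + 2 * B &
      L / alpha <= 2 * r + 2 * B].
  move=> al0 ala; have := bounds (Num.sqrt alpha).
  rewrite sqrtr_gt0 sqr_sqrtr ?(ltW al0)// -CVE// => /(_ al0 ala)[def ub lb].
  split => //; rewrite /V; move: ub lb; rewrite -/L.
  case: ('E_P[cond_var P Y (CV g Y omega alpha)])%E => [r| |]//.
  - rewrite -!EFinM -EFinD !lee_fin => ub lb.
    by exists r; split.
  - by rewrite mulrNy gtr0_sg// mul1e.
have tv0 : - (K.-1)%:R^-1 < rho -> 0 < total_variance K sigma2 rho.
  move=> h; rewrite /total_variance mulr_gt0// ?mulr_gt0 ?ltr0n//.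
  have : (K.-1)%:R * - (K.-1)%:R^-1 < (K.-1)%:R * rho by rewrite ltr_pM2l.
  by rewrite mulrN divff ?gt_eqF// -subr_gt0 opprK addrC.
split.
- near=> alpha; apply: (bnd alpha _ _).1.
  + near: alpha; exact: nbhs_right_gt.
  + near: alpha; apply: nbhs_right_le; exact: divr_gt0.
- move=> rhoE.
  have L0 : L = 0.
    rewrite /L /leading_const /total_variance rhoE mulrN divff ?gt_eqF//.
    by rewrite subrr !mulr0 mul0r.
  apply/eqO_exP; exists (2 * B + 1); first by rewrite ltr_wpDl// mulr_ge0.
  near=> alpha.
  have al0 : 0 < alpha by near: alpha; exact: nbhs_right_gt.
  have ala : alpha <= a / 2 by near: alpha; apply: nbhs_right_le; exact: divr_gt0.
  have [_ [r [-> ub lb]]] := bnd alpha al0 ala.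
  rewrite /= normr1 mulr1 ler_norml.
  by move: ub lb; rewrite L0 mul0r mulr0; lra.
- move=> /tv0 tv.
  have L0 : 0 < L.
    rewrite /L /leading_const; apply: mulr_gt0.
      by apply: mulr_gt0 => //; rewrite divr_gt0// exprn_gt0// ltr0n.
    apply: fine_gt0; rewrite resid_lty andbT.
    by move: resid0; rewrite unlock.
  rewrite eqThetaE qualifE; apply/asboolP.
  exists (L / 4, 3 * L) => /=; first by rewrite divr_gt0//= mulr_gt0.
  near=> alpha.
  have al0 : 0 < alpha by near: alpha; exact: nbhs_right_gt.
  have ala : alpha <= a / 2 by near: alpha; apply: nbhs_right_le; exact: divr_gt0.
  have [_ [r [-> ub lb]]] := bnd alpha al0 ala.
  (* Below this threshold the bounded part is at most a quarter of L / alpha. *)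
  have aL : alpha <= L / (4 * (B + 1)).
    near: alpha; apply: nbhs_right_le.
    by rewrite divr_gt0// mulr_gt0// ltr_wpDl.
  have B4 : B <= L / alpha / 4.
    have B1 : 0 < 4 * (B + 1) by rewrite mulr_gt0// ltr_wpDl.
    move: aL; rewrite !ler_pdivlMr//; nra.
  have La : 0 < L / alpha by rewrite divr_gt0.
  have r0 : 0 < r by lra.
  rewrite /= !gtr0_norm ?invr_gt0//; split; first by lra.
  by lra.
Unshelve. all: by end_near. Qed.
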